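(* Setting and construction as in the context. Assume (i) $g$ is convex and Lipschitz continuous with Lipschitz constant $L_g\ge 0$, and (ii) for every $t\in[0,T]$ the set $\mathbb{W}(t)=B(t)\mathbb{U}\ominus(-E(t)\mathbb{D})$ is nonempty. Let $N\in\mathbb{N}$, levels $\gamma_1,\dots,\gamma_N\in g(\mathbb{R}^n)$, integers $n_k\in\mathbb{N}$, points $\bar x_{i,k}\in g^{-1}(\{\gamma_k\})$ ($1\le i\le n_k$), and controls $\omega_{i,k}\in\mathscr{W}[0,T]$ be given; let $\xi^\star_{i,k}$ be the solution on $[0,T]$ of $\dot\xi(s)=A(s)\xi(s)+\omega_{i,k}(s)$ a.e., $\xi(T)=\bar x_{i,k}$, let $\Omega^\star_k(t)=\mathrm{conv}(\{\xi^\star_{i,k}(t)\}_{i=1}^{n_k})$, and $$\bar v(t,x)=\min_{k\in\{1,\dots,N\}}\Big(L_g\inf_{\xi\in\Omega^\star_k(t)}\|\Phi_A(T,t)(x-\xi)\|+\gamma_k\Big).$$ Then $\bar v(t,x)\ge v(t,x)$ for all $(t,x)\in[0,T]\times\mathbb{R}^n$, where $v$ is the value function defined in the context.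
   Context: Fix $T>0$ and integers $n,m,\ell\ge 1$. Let $A\in C([0,T];\mathbb{R}^{n\times n})$, $B\in C([0,T];\mathbb{R}^{n\times m})$, $E\in C([0,T];\mathbb{R}^{n\times \ell})$, and let $\mathbb{U}\subset\mathbb{R}^m$, $\mathbb{D}\subset\mathbb{R}^\ell$ be compact, convex and nonempty; $g\in C(\mathbb{R}^n;\mathbb{R})$. For $0\le t\le T$, $\mathscr{U}[t,T]$ (resp. $\mathscr{D}[t,T]$) is the set of measurable maps $[t,T]\to\mathbb{U}$ (resp. $[t,T]\to\mathbb{D}$), and $\xi^{u,d}_{t,x}$ is the solution of $\dot\xi(s)=A(s)\xi(s)+B(s)u(s)+E(s)d(s)$ a.e. $s\in(t,T)$, $\xi(t)=x$. A map $\delta:\mathscr{U}[t,T]\to\mathscr{D}[t,T]$ is a non-anticipative strategy if for every $s\in[t,T]$ and $u_1,u_2\in\mathscr{U}[t,T]$, $u_1=u_2$ a.e. on $[t,s]$ implies $\delta[u_1]=\delta[u_2]$ a.e. on $[t,s]$; $\Delta[t,T]$ denotes the set of these. The value function is $v(t,x)=\sup_{\delta\in\Delta[t,T]}\inf_{u\in\mathscr{U}[t,T]}g(\xi^{u,\delta[u]}_{t,x}(T))$. $\Phi_A(s,\tau)$ is the state-transition matrix of $\dot y=A(s)y$. For $Y,Z\subseteq\mathbb{R}^n$: $Y\oplus Z=\{y+z\}$, $Y\ominus Z=\{c:\{c\}\oplus Z\subseteq Y\}$, $PY=\{Py:y\in Y\}$. $\mathscr{W}[t,T]$ is the set of measurable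 $\omega:[t,T]\to\mathbb{R}^n$ with $\omega(s)\in\mathbb{W}(s)$ for all $s$. *)

(* Defs.v *)
From HB Require Import structures.
From mathcomp Require Import all_boot all_order all_algebra.
From mathcomp Require Import all_classical all_reals all_analysis.
Set Implicit Arguments. Unset Strict Implicit. Unset Printing Implicit Defensive.
Import Order.TTheory GRing.Theory Num.Theory.
Import numFieldNormedType.Exports.
Local Open Scope classical_set_scope.
Local Open Scope ring_scope.

Definition enorm {R : realType} {n : nat} (v : 'cV[R]_n) : R :=
  Num.sqrt (\sum_(i < n) v i 0 ^+ 2).

Definition oint {R : realType} (a b : R) (f : R -> R) : R :=
  if a <= b then Rintegral (@lebesgue_measure R) `[a, b] f
  else - Rintegral (@lebesgue_measure R) `[b, a] f.

Definition is_convex_set {R : realType} {n : nat} (C : set 'cV[R]_n) : Prop :=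
  forall x y, C x -> C y -> forall lam : R, 0 <= lam <= 1 ->
    C (lam *: x + (1 - lam) *: y).

Definition is_convex_fun {R : realType} {n : nat} (f : 'cV[R]_n -> R) : Prop :=
  forall x y (lam : R), 0 <= lam <= 1 ->
    f (lam *: x + (1 - lam) *: y) <= lam * f x + (1 - lam) * f y.

Definition conv_hull {R : realType} {n : nat} (S : set 'cV[R]_n) : set 'cV[R]_n :=
  \bigcap_(C in [set C | is_convex_set C /\ S `<=` C]) C.

Definition mimage {R : realType} {p q : nat} (P : 'M[R]_(p, q)) (Y : set 'cV[R]_q)
  : set 'cV[R]_p := [set P *m y | y in Y].
Definition msum {R : realType} {p : nat} (Y Z : set 'cV[R]_p) : set 'cV[R]_p :=
  [set yz | exists y, exists z, Y y /\ Z z /\ yz = y + z].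
Definition mdiff {R : realType} {p : nat} (Y Z : set 'cV[R]_p) : set 'cV[R]_p :=
  [set c | msum [set c] Z `<=` Y].

Definition Wset {R : realType} {n m l : nat} (B : R -> 'M[R]_(n, m))
  (E : R -> 'M[R]_(n, l)) (U : set 'cV[R]_m) (D : set 'cV[R]_l) (t : R)
  : set 'cV[R]_n :=
  mdiff (mimage (B t) U) (mimage (- E t) D).

Definition admissible {R : realType} {p : nat} (t T : R) (V : R -> set 'cV[R]_p)
  (u : R -> 'cV[R]_p) : Prop :=
  (forall i : 'I_p, measurable_fun `[t, T] (fun s => u s i 0)) /\
  (forall s, t <= s <= T -> V s (u s)).

(* xi solves xi' = A xi + B u + E d a.e. on (t,T), xi(t) = x  (Caratheodory) *)
Definition is_traj {R : realType} {n m l : nat} (A : R -> 'M[R]_n)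
  (B : R -> 'M[R]_(n, m)) (E : R -> 'M[R]_(n, l)) (t T : R) (x : 'cV[R]_n)
  (u : R -> 'cV[R]_m) (d : R -> 'cV[R]_l) (xi : R -> 'cV[R]_n) : Prop :=
  {within `[t, T], continuous xi} /\
  forall s, t <= s <= T -> forall i : 'I_n,
    xi s i 0 = x i 0 + oint t s (fun r => (A r *m xi r + B r *m u r + E r *m d r) i 0).

Definition nonanticipative {R : realType} {m l : nat} (t T : R)
  (U : set 'cV[R]_m) (D : set 'cV[R]_l)
  (delta : (R -> 'cV[R]_m) -> (R -> 'cV[R]_l)) : Prop :=
  (forall u, admissible t T (fun _ => U) u -> admissible t T (fun _ => D) (delta u)) /\
  (forall s, t <= s <= T -> forall u1 u2,
     admissible t T (fun _ => U) u1 -> admissible t T (fun _ => U) u2 ->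
     {ae (@lebesgue_measure R), forall r, t <= r <= s -> u1 r = u2 r} ->
     {ae (@lebesgue_measure R), forall r, t <= r <= s -> delta u1 r = delta u2 r}).

Definition value {R : realType} {n m l : nat} (A : R -> 'M[R]_n)
  (B : R -> 'M[R]_(n, m)) (E : R -> 'M[R]_(n, l)) (U : set 'cV[R]_m)
  (D : set 'cV[R]_l) (g : 'cV[R]_n -> R) (T t : R) (x : 'cV[R]_n) : \bar R :=
  ereal_sup [set ereal_inf
      [set (g (xi T))%:E | xi in
         [set xi | exists u, admissible t T (fun _ => U) u /\ is_traj A B E t T x u (delta u) xi]]
    | delta in [set delta | nonanticipative t T U D delta]].

Definition is_state_transition {R : realType} {n : nat} (A : R -> 'M[R]_n) (T : R)
  (Phi : R -> R -> 'M[R]_n) : Prop :=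
  forall tau, 0 <= tau <= T ->
    {within `[0, T], continuous (fun s => Phi s tau)} /\
    forall s, 0 <= s <= T -> forall i j : 'I_n,
      Phi s tau i j = (1%:M : 'M[R]_n) i j + oint tau s (fun r => (A r *m Phi r tau) i j).

(* xi solves xi' = A xi + w a.e. on [0,T], xi(T) = xT *)
Definition is_backward_traj {R : realType} {n : nat} (A : R -> 'M[R]_n) (T : R)
  (xT : 'cV[R]_n) (w : R -> 'cV[R]_n) (xi : R -> 'cV[R]_n) : Prop :=
  {within `[0, T], continuous xi} /\
  forall s, 0 <= s <= T -> forall i : 'I_n,
    xi s i 0 = xT i 0 + oint T s (fun r => (A r *m xi r + w r) i 0).

Definition vbar {R : realType} {n N : nat} (Lg : R) (nk : 'I_N -> nat)
  (gam : 'I_N -> R) (xis : forall k : 'I_N, 'I_(nk k) -> R -> 'cV[R]_n)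
  (Phi : R -> R -> 'M[R]_n) (T t : R) (x : 'cV[R]_n) : \bar R :=
  ereal_inf [set (Lg%:E * ereal_inf
        [set (enorm (Phi T t *m (x - y)))%:E | y in conv_hull (range (fun i => xis k i t))]
        + (gam k)%:E)%E | k in [set: 'I_N]].

(* Main.v *)
(** The upper value is approached by a delayed response. Fix a strategy [delta], a
    measurable selection [w] of [W] and a solution [zeta] of [zeta' = A zeta + w].
    Since [w - E d] always lies in [B U], a control could cancel the disturbance
    exactly if it knew [d]; it does not, because [delta[u]] may depend on the present
    value of [u], possibly discontinuously. So let the control answer with a delay
    [h]: [B (s - h) u(s)] approximates [w - E delta[u]] at time [s - h]. Such a [u] is
    obtained after finitely many iterations, by non-anticipativity, and measurability
    is free because it suffices to choose among the points of a finite net of [U].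
    Translating the integral by [h] and using the uniform continuity of [B], the defect
    [B u + E delta[u] - w] has a uniformly small primitive, so by Gronwall the terminal
    state is close to [zeta T + Phi T t (x - zeta t)]. The starting points [zeta t] of
    the solutions [zeta] with [g (zeta T) <= gamma_k] form a convex set containing all
    the [xis k i t], hence their convex hull, and the Lipschitz bound on [g] concludes. *)

Require Import Defs.
From HB Require Import structures.
From mathcomp Require Import all_boot all_order all_algebra.
From mathcomp Require Import all_classical all_reals all_analysis.
From mathcomp Require Import measurable_realfun ring lra.
Import Order.TTheory GRing.Theory Num.Theory.
Import numFieldNormedType.Exports.
Local Open Scope classical_set_scope.
Local Open Scope ring_scope.

Set Implicit Arguments.
Unset Strict Implicit.
Unset Printing Implicit Defensive.

(** * Bounded measurable functions on the line *)

Section bounded_measurable.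
Context {R : realType}.
Implicit Types (D : set R) (f g : R -> R) (a b c : R).
Notation mu := (@lebesgue_measure R).

(** Boundedness makes the class stable under products and integrable on every segment, so that
    integrability conditions reduce to closure properties. *)
Definition bounded_measurable D f :=
  measurable_fun D f /\ exists M, forall x, D x -> `|f x| <= M.

Lemma bounded_measurable_cst D c : bounded_measurable D (fun=> c).
Proof. by split; [exact: measurable_cst|exists `|c|]. Qed.

Lemma bounded_measurableD D f g : bounded_measurable D f ->
  bounded_measurable D g -> bounded_measurable D (fun x => f x + g x).
Proof.
move=> [mf [M fM]] [mg [N gN]]; split; first exact: measurable_funD.
by exists (M + N) => x Dx; apply: le_trans (ler_normD _ _) _; rewrite lerD ?fM ?gN.
Qed.

Lemma bounded_measurableM D f g : bounded_measurable D f ->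
  bounded_measurable D g -> bounded_measurable D (fun x => f x * g x).
Proof.
move=> [mf [M fM]] [mg [N gN]]; split; first exact: measurable_funM.
by exists (M * N) => x Dx; rewrite normrM ler_pM ?fM ?gN.
Qed.

Lemma bounded_measurableN D f : bounded_measurable D f ->
  bounded_measurable D (fun x => - f x).
Proof.
move=> [mf [M fM]]; split; first exact: measurableT_comp.
by exists M => x Dx; rewrite normrN fM.
Qed.

Lemma bounded_measurableB D f g : bounded_measurable D f ->
  bounded_measurable D g -> bounded_measurable D (fun x => f x - g x).
Proof.
by move=> ? ?; apply: bounded_measurableD => //; exact: bounded_measurableN.
Qed.

Lemma bounded_measurable_sum D (I : Type) (s : seq I) (F : I -> R -> R) :
  (forall i, bounded_measurable D (F i)) ->
  bounded_measurable D (fun x => \sum_(i <- s) F i x).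
Proof.
move=> bF; split; first by apply: measurable_sum => i; case: (bF i).
have /choice[M FM] := fun i => (bF i).2.
exists (\sum_(i <- s) M i) => x Dx; apply: le_trans (ler_norm_sum _ _ _) _.
by apply: ler_sum => i _; exact: FM.
Qed.

Lemma bounded_measurableS D D' f : measurable D -> D' `<=` D ->
  bounded_measurable D f -> bounded_measurable D' f.
Proof.
move=> mD DD' [mf [M fM]]; split; first exact: measurable_funS mf.
by exists M => x /DD'; exact: fM.
Qed.

Lemma subset_segment a b c (d : R) : a <= b -> c <= d -> `[b, c] `<=` `[a, d].
Proof. by move=> ab cd x /=; rewrite !in_itv/= => /andP[? ?]; lra. Qed.

Lemma bounded_measurable_integrable a b f : bounded_measurable `[a, b] f ->
  mu.-integrable `[a, b] (EFin \o f).
Proof.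
move=> [mf [M fM]]; apply: measurable_bounded_integrable => //.
- by rewrite /= lebesgue_measure_itv/=; case: ifPn => _; rewrite ?EFinN -?EFinB ltry.
- exists M; split; first exact: num_real.
  by move=> N MN x abx; apply: le_trans (fM _ abx) (ltW MN).
Qed.

Lemma segment_measure a b : a <= b -> fine (mu `[a, b]%classic) = b - a.
Proof.
move=> ab; rewrite lebesgue_measure_itv/= lte_fin; case: ltP => //=.
by move=> ba; have -> : b = a by [lra]; rewrite subrr.
Qed.

Lemma Rint_le_bound a b f (M : R) : a <= b -> bounded_measurable `[a, b] f ->
  (forall x, a <= x <= b -> `|f x| <= M) ->
  `|\int[mu]_(x in `[a, b]) f x| <= M * (b - a).
Proof.
move=> ab bf fM; have If := bounded_measurable_integrable bf.
apply: le_trans (le_normr_Rintegral _ If) _ => //.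
rewrite -(segment_measure ab) -(Rintegral_cst mu)//.
apply: le_Rintegral => //.
- exact: integrable_norm.
- exact/bounded_measurable_integrable/bounded_measurable_cst.
Qed.

Lemma Rint_itv1 a f : \int[mu]_(x in `[a, a]) f x = 0.
Proof. by rewrite set_itv1 Rintegral_set1. Qed.

Lemma Rint_split a b c f : a <= b -> b <= c -> bounded_measurable `[a, c] f ->
  \int[mu]_(x in `[a, c]) f x =
  \int[mu]_(x in `[a, b]) f x + \int[mu]_(x in `[b, c]) f x.
Proof.
move=> ab bc bf; have If := bounded_measurable_integrable bf.
have := @Rintegral_itvB _ f (BLeft a) (BRight c) b If.
rewrite !bnd_simp => /(_ ab bc) H.
rewrite Rintegral_itv_obnd_cbnd in H; first by rewrite -H; ring.
apply: integrableS If => //; apply: subset_itvr; rewrite bnd_simp//.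
Qed.

Lemma Rint_ext a b f g : (forall x, a <= x <= b -> f x = g x) ->
  \int[mu]_(x in `[a, b]) f x = \int[mu]_(x in `[a, b]) g x.
Proof. by move=> fg; apply: eq_Rintegral => x; rewrite inE/= in_itv/=; exact: fg. Qed.

Lemma ae_imp (P Q : R -> Prop) : (forall x, P x -> Q x) ->
  {ae mu, forall x, P x} -> {ae mu, forall x, Q x}.
Proof.
move=> PQ [A [mA A0 PA]]; exists A; split => // x nQ; apply: PA => /=.
by apply: contra_not nQ; exact: PQ.
Qed.

Lemma ae_neq (P : R -> Prop) a : (forall x, x != a -> P x) -> {ae mu, forall x, P x}.
Proof.
move=> HP; exists [set a]; split => //; first exact: lebesgue_measure_set1.
by move=> x /= nP; apply: contrapT => /eqP xa; apply: nP; exact: HP.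
Qed.

Lemma measurable_translation c : measurable_fun [set: R] (fun x : R => x - c).
Proof.
by apply: measurable_funB => //; exact: measurable_cst.
Qed.

(** The pushforward of [mu] by the translation agrees with [mu] on the intervals []a, b]], and these
    determine the measure. *)
Lemma lebesgue_measure_translation c (A : set R) : measurable A ->
  mu ((fun x => x - c) @^-1` A) = mu A.
Proof.
move=> mA; have ms := measurable_translation c.
apply/esym.
pose f := (fun x : R => x - c) : measurableTypeR R -> measurableTypeR R.
have mf : measurable_fun setT f by [].
have := @lebesgue_measure_unique R
  (measure_function_pushforward__canonical__measure_function_Measure mu mf).
move=> /(_ _ _ mA) /=; apply => _ [[a b] /= _ <-].
rewrite /pushforward (_ : f @^-1` _ = `]a + c, b + c]%classic); last first.
  by apply/seteqP; split => x; rewrite /f /= !in_itv/=; lra.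
rewrite !lebesgue_measure_itv/= !lte_fin ltrD2r; case: ifP => // _.
by rewrite -!EFinB; congr EFin; ring.
Qed.

(** This carries an almost everywhere identity across one delay. *)
Lemma ae_translation c (P : R -> Prop) : {ae mu, forall x, P x} ->
  {ae mu, forall x, P (x - c)}.
Proof.
move=> [A [mA A0 PA]]; exists ((fun x => x - c) @^-1` A); split => //.
- rewrite -[X in measurable X]setTI; exact: measurable_translation.
- by rewrite lebesgue_measure_translation.
- by move=> x /= nP; apply: PA.
Qed.

Lemma bounded_measurable_translation c f : bounded_measurable [set: R] f ->
  bounded_measurable [set: R] (fun x => f (x - c)).
Proof.
move=> [mf [M fM]]; split; last by exists M => x _; exact: fM.
by apply: (measurableT_comp mf); exact: measurable_translation.
Qed.

(** Change of variables along the pushforward of [mu] by the translation, which is [mu] again. *)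
Lemma Rint_translation a b c f : bounded_measurable [set: R] f ->
  \int[mu]_(x in `[a, b]) f (x - c) = \int[mu]_(x in `[a - c, b - c]) f x.
Proof.
move=> bf; rewrite /Rintegral; congr fine.
have mc := measurable_translation c.
have E : (fun x => x - c) @^-1` `[a - c, b - c] = `[a, b]%classic.
  by apply/seteqP; split => x /=; rewrite !in_itv/=; lra.
have := @integral_pushforward _ _ (measurableTypeR R) (measurableTypeR R) R
  (fun x => x - c) mc mu `[a - c, b - c]%classic (EFin \o f).
rewrite E /= => <- //.
- apply: eq_measure_integral => A mA _.
  exact: lebesgue_measure_translation.
- by apply/measurable_EFinP; case: bf.
- apply: bounded_measurable_integrable.
  exact: bounded_measurableS (bounded_measurable_translation c bf).
Qed.

Lemma Rint_ae a b f g : bounded_measurable `[a, b] f ->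
  bounded_measurable `[a, b] g ->
  {ae mu, forall x, a <= x <= b -> f x = g x} ->
  \int[mu]_(x in `[a, b]) f x = \int[mu]_(x in `[a, b]) g x.
Proof.
move=> [mf _] [mg _] fg; rewrite /Rintegral; congr fine.
apply: ae_eq_integral => //; try exact/measurable_EFinP.
by apply: ae_imp fg => x fg /=; rewrite in_itv/= => /fg ->.
Qed.

Lemma RintD a b f g : bounded_measurable `[a, b] f ->
  bounded_measurable `[a, b] g ->
  \int[mu]_(x in `[a, b]) (f x + g x) =
  \int[mu]_(x in `[a, b]) f x + \int[mu]_(x in `[a, b]) g x.
Proof.
by move=> bf bg; apply: RintegralD => //; exact: bounded_measurable_integrable.
Qed.

Lemma RintB a b f g : bounded_measurable `[a, b] f ->
  bounded_measurable `[a, b] g ->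
  \int[mu]_(x in `[a, b]) (f x - g x) =
  \int[mu]_(x in `[a, b]) f x - \int[mu]_(x in `[a, b]) g x.
Proof.
by move=> bf bg; apply: RintegralB => //; exact: bounded_measurable_integrable.
Qed.

Lemma RintZ a b f c : bounded_measurable `[a, b] f ->
  \int[mu]_(x in `[a, b]) (c * f x) = c * \int[mu]_(x in `[a, b]) f x.
Proof.
by move=> bf; apply: RintegralZl => //; exact: bounded_measurable_integrable.
Qed.

Lemma Rint_sum a b (I : Type) (s : seq I) (F : I -> R -> R) :
  (forall i, bounded_measurable `[a, b] (F i)) ->
  \int[mu]_(x in `[a, b]) (\sum_(i <- s) F i x) =
  \sum_(i <- s) \int[mu]_(x in `[a, b]) F i x.
Proof.
move=> bF; elim: s => [|i s IH].
  rewrite big_nil (@Rint_ext _ _ _ (fun=> 0)) => [|x _]; last by rewrite big_nil.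
  by rewrite Rintegral_cst// mul0r.
rewrite big_cons -IH -RintD//; last exact: bounded_measurable_sum.
by apply: Rint_ext => x _; rewrite big_cons.
Qed.

Lemma within_continuous_bounded_measurable a b f :
  {within `[a, b], continuous f} -> bounded_measurable `[a, b] f.
Proof.
move=> cf; split; first exact: subspace_continuous_measurable_fun.
have := compact_bounded (continuous_compact cf (@segment_compact _ a b)).
move=> [M [_ fM]]; exists (M + 1) => x abx; apply: fM; first lra.
by exists x.
Qed.

Lemma lipschitz_within_continuous a b f (L : R) :
  (forall x y, a <= x -> x <= y -> y <= b -> `|f y - f x| <= L * (y - x)) ->
  {within `[a, b], continuous f}.
Proof.
move=> fL; have {}fL x y : a <= x <= b -> a <= y <= b ->
    `|f x - f y| <= `|L| * `|x - y|.
  move=> xab yab; have [xy|yx] := leP x y.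
  - rewrite distrC; apply: le_trans (fL _ _ _ _ _) _; try lra.
    by rewrite distrC (ger0_norm (_ : 0 <= y - x)) ?ler_wpM2r ?ler_norm ?subr_ge0.
  - apply: le_trans (fL _ _ _ _ _) _; try lra.
    rewrite (gtr0_norm (_ : 0 < x - y)) ?subr_gt0//.
    by rewrite ler_wpM2r ?ler_norm ?subr_ge0 ?ltW.
apply/subspace_continuousP => x /=; rewrite in_itv/= => xab.
apply/cvgrPdist_le => e e0; rewrite near_withinE.
have L1 : 0 < `|L| + 1 by rewrite ltr_wpDl.
near=> y; rewrite /= in_itv/= => yab.
apply: le_trans (fL _ _ xab yab) _.
have : `|x - y| <= e / (`|L| + 1).
  near: y; apply: (@cvgr_dist_le _ _ _ (nbhs x) _ id) => //; exact: divr_gt0.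
rewrite ler_pdivlMr// => H; have := normr_ge0 (x - y); lra.
Unshelve. all: by end_near. Qed.

(** Heine-Cantor, from the near-covering form of compactness: the radius [h] runs along the filter
    of right neighbourhoods of [0], so local choices of radius yield a uniform one. *)
Lemma within_continuous_unif a b f (e : R) : {within `[a, b], continuous f} ->
  0 < e -> exists2 d : R, 0 < d & forall x y, a <= x <= b -> a <= y <= b ->
    `|x - y| < d -> `|f x - f y| <= e.
Proof.
move=> /subspace_continuousP cf e0.
have /compact_near_coveringP/(_ _ (0 : R)^'+ (fun h x => forall y, a <= y <= b ->
    `|x - y| < h -> a <= x <= b -> `|f x - f y| <= e)) := @segment_compact _ a b.
case.
  move=> x abx; have := cf x abx => /cvgrPdist_le/(_ (e / 2)).
  rewrite divr_gt0// near_withinE => /(_ isT)/nbhs_ballP[r /= r0 rf].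
  (* If [y] is within [r / 2] of [x] and [z] within [h] of [y], then [z] stays within [r] of [x]. *)
  exists (ball x (r / 2), [set h | h < r / 2]) => /=.
    split; first by apply: nbhsx_ballx; rewrite divr_gt0.
    by apply: nbhs_right_lt; rewrite divr_gt0.
  move=> [y h] /= []; rewrite /ball/= => xy hr z zab yzh yab.
  have Hy : `|f x - f y| <= e / 2.
    by apply: rf => //=; rewrite /ball/=; lra.
  have Hz : `|f x - f z| <= e / 2.
    apply: rf => //=.
    rewrite /ball/= (_ : x - z = (x - y) + (y - z)); last ring.
    by apply: le_lt_trans (ler_normD _ _) _; lra.
  rewrite (_ : f y - f z = (f x - f z) - (f x - f y)); last ring.
  apply: le_trans (ler_normB _ _) _; lra.
move=> d /= d0 H.
exists (d / 2); first by rewrite divr_gt0.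
move=> x y xab yab xyd; apply: (H (d / 2)) => //=.
- by rewrite sub0r normrN gtr0_norm; lra.
- by lra.
Qed.

End bounded_measurable.

(** * Geometrically convergent sequences *)

Section geometric.
Context {R : realType}.
Implicit Types (x y C : R).

Lemma ler_addgeo x y C : (forall k, x <= y + C / 2 ^+ k) -> x <= y.
Proof.
move=> H; apply/ler_addgt0Pr => e e0.
have [k Ck] : exists k, C / e <= k%:R.
  exists (Num.bound `|C / e|).
  by apply: le_trans (ler_norm _) (ltW (archi_boundP (normr_ge0 _))).
apply: le_trans (H k) _; rewrite lerD2l ler_pdivrMr ?exprn_gt0//.
have : (k%:R : R) <= 2 ^+ k by rewrite -natrX ler_nat ltnW// ltn_expl.
rewrite ler_pdivrMr// in Ck => k2; apply: le_trans Ck _.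
by rewrite mulrC ler_pM2l.
Qed.

(** Nested intervals: [u k - 2 * C / 2 ^+ k] increases and [u k + 2 * C / 2 ^+ k] decreases, so the
    supremum of the former lies between them for every [k]. *)
Lemma geometric_limit (u : R^nat) C : (forall k, `|u k.+1 - u k| <= C / 2 ^+ k) ->
  exists l, forall k, `|u k - l| <= 2 * C / 2 ^+ k.
Proof.
move=> uC.
have H k : 2 ^+ k.+1 != 0 :> R by rewrite expf_neq0.
have H0 k : 2 ^+ k != 0 :> R by rewrite expf_neq0.
have E k : 2 * C / 2 ^+ k = C / 2 ^+ k + 2 * C / 2 ^+ k.+1.
  by rewrite exprS; field; exact: H0.
have lo : forall k j, u k - 2 * C / 2 ^+ k <= u (k + j)%N - 2 * C / 2 ^+ (k + j).
  move=> k; elim => [|j IH]; first by rewrite addn0.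
  apply: le_trans IH _; rewrite addnS.
  by have := uC (k + j)%N; have := E (k + j)%N; rewrite ler_norml; lra.
have hi : forall k j, u (k + j)%N + 2 * C / 2 ^+ (k + j) <= u k + 2 * C / 2 ^+ k.
  move=> k; elim => [|j IH]; first by rewrite addn0.
  apply: le_trans IH; rewrite addnS.
  by have := uC (k + j)%N; have := E (k + j)%N; rewrite ler_norml; lra.
have C0 k : 0 <= C / 2 ^+ k by apply: le_trans (normr_ge0 _) (uC k).
pose S := [set u k - 2 * C / 2 ^+ k | k in [set: nat]].
have ubS k : ubound S (u k + 2 * C / 2 ^+ k).
  move=> _ [j _ <-]; apply: le_trans (lo j k) _.
  apply: le_trans (hi k j); rewrite addnC.
  have := C0 (k + j)%N; rewrite -!mulrA; lra.
have S0 : S !=set0 by exists (u 0 - 2 * C / 2 ^+ 0); exists 0%N.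
exists (sup S) => k; rewrite ler_norml.
have : u k - 2 * C / 2 ^+ k <= sup S.
  by apply: ub_le_sup; [exists (u 0 + 2 * C / 2 ^+ 0); exact: ubS|exists k].
have : sup S <= u k + 2 * C / 2 ^+ k by apply: ge_sup => //; exact: ubS.
lra.
Qed.

End geometric.

(** * Matrix-valued functions, entry by entry *)

Section matrix_functions.
Context {R : realType}.
Implicit Types (D : set R).

Definition bounded_measurable_mx p q D (F : R -> 'M[R]_(p, q)) :=
  forall i j, bounded_measurable D (fun x => F x i j).

Lemma bounded_measurable_mxD p q D (F G : R -> 'M[R]_(p, q)) :
  bounded_measurable_mx D F -> bounded_measurable_mx D G ->
  bounded_measurable_mx D (fun x => F x + G x).
Proof.
move=> bF bG i j; rewrite (_ : (fun _ => _) = fun x => F x i j + G x i j).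
  exact: bounded_measurableD.
by apply/funext => x; rewrite mxE.
Qed.

Lemma bounded_measurable_mxB p q D (F G : R -> 'M[R]_(p, q)) :
  bounded_measurable_mx D F -> bounded_measurable_mx D G ->
  bounded_measurable_mx D (fun x => F x - G x).
Proof.
move=> bF bG i j; rewrite (_ : (fun _ => _) = fun x => F x i j - G x i j).
  exact: bounded_measurableB.
by apply/funext => x; rewrite !mxE.
Qed.

Lemma bounded_measurable_mxM p q r D (F : R -> 'M[R]_(p, q)) (G : R -> 'M[R]_(q, r)) :
  bounded_measurable_mx D F -> bounded_measurable_mx D G ->
  bounded_measurable_mx D (fun x => F x *m G x).
Proof.
move=> bF bG i j; rewrite (_ : (fun _ => _) = fun x => \sum_k F x i k * G x k j).
  by apply: bounded_measurable_sum => k; exact: bounded_measurableM.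
by apply/funext => x; rewrite !mxE.
Qed.

Lemma bounded_measurable_mxZ p q D (c : R) (F : R -> 'M[R]_(p, q)) :
  bounded_measurable_mx D F -> bounded_measurable_mx D (fun x => c *: F x).
Proof.
move=> bF i j; rewrite (_ : (fun _ => _) = fun x => c * F x i j).
  by apply: bounded_measurableM => //; exact: bounded_measurable_cst.
by apply/funext => x; rewrite mxE.
Qed.

Lemma bounded_measurable_mx_cst p q D (F : 'M[R]_(p, q)) :
  bounded_measurable_mx D (fun=> F).
Proof. by move=> i j; exact: bounded_measurable_cst. Qed.

Lemma bounded_measurable_mxS p q D D' (F : R -> 'M[R]_(p, q)) :
  measurable D -> D' `<=` D ->
  bounded_measurable_mx D F -> bounded_measurable_mx D' F.
Proof. by move=> mD DD' bF i j; exact: bounded_measurableS (bF i j). Qed.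

Lemma bounded_measurable_mx_bound p q D (F : R -> 'M[R]_(p, q)) :
  bounded_measurable_mx D F ->
  exists2 C : R, 0 < C & forall r i j, D r -> `|F r i j| <= C.
Proof.
move=> bF; have /choice[K FK] := fun ij : 'I_p * 'I_q => (bF ij.1 ij.2).2.
exists (1 + \sum_ij `|K ij|).
  by rewrite ltr_pwDl// sumr_ge0.
move=> r i j Dr; apply: le_trans (FK (i, j) r Dr) _.
rewrite (bigD1 (i, j))//=; have := ler_norm (K (i, j)).
have : 0 <= \sum_(ij | ij != (i, j)) `|K ij| by rewrite sumr_ge0.
lra.
Qed.

Lemma mulmx_bound p q (F : 'M[R]_(p, q)) (v : 'cV[R]_q) (C K : R) i :
  (forall i j, `|F i j| <= C) -> (forall j, `|v j 0| <= K) ->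
  `|(F *m v) i 0| <= q%:R * C * K.
Proof.
move=> FC vK; rewrite mxE; apply: le_trans (ler_norm_sum _ _ _) _.
apply: le_trans (_ : \sum_(j < q) C * K <= _).
  by apply: ler_sum => j _; rewrite normrM ler_pM.
by rewrite sumr_const card_ord -[leLHS]mulr_natl mulrA.
Qed.

Lemma within_continuous_entry p q D (F : R -> 'M[R]_(p, q)) i j :
  {within D, continuous F} -> {within D, continuous (fun x => F x i j)}.
Proof.
move=> /subspace_continuousP cF; apply/subspace_continuousP => x Dx.
apply: (cvg_comp (G := nbhs (F x)) F (fun M : 'M[R]_(p, q) => M i j)).
  exact: cF.
exact: coord_continuous.
Qed.

Lemma within_continuous_bounded_measurable_mx p q a b (F : R -> 'M[R]_(p, q)) :
  {within `[a, b], continuous F} -> bounded_measurable_mx `[a, b] F.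
Proof.
move=> cF i j; apply: within_continuous_bounded_measurable.
exact: within_continuous_entry.
Qed.

Lemma lipschitz_within_continuous_mx p q a b (F : R -> 'M[R]_(p, q)) (L : R) :
  (forall i j x y, a <= x -> x <= y -> y <= b ->
    `|F y i j - F x i j| <= L * (y - x)) ->
  {within `[a, b], continuous F}.
Proof.
move=> FL; have cF i j := lipschitz_within_continuous (FL i j).
apply/subspace_continuousP => x xab.
apply/cvg_ballP => e e0.
have H i j : \forall y \near within `[a, b] (nbhs x), ball (F x i j) e (F y i j).
  by have /subspace_continuousP/(_ x xab)/cvg_ballP/(_ e e0) := cF i j.
have : \forall y \near within `[a, b] (nbhs x),
    forall ij : 'I_p * 'I_q, ball (F x ij.1 ij.2) e (F y ij.1 ij.2).
  by apply: filter_forall => ij; exact: H.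
by apply: filterS => y Hy; split => // i j; exact: (Hy (i, j)).
Qed.

End matrix_functions.

(** * Linear integral equations *)

Section linear_equations.
Context {R : realType}.
Notation mu := (@lebesgue_measure R).

Lemma continuous_weight (a K M : R) :
  continuous (fun r => M * (K * expR (2 * M * (r - a)))).
Proof.
move=> r; apply: cvgM; first exact: cvg_cst.
apply: cvgM; first exact: cvg_cst.
apply: (@continuous_comp _ _ _ (fun r => 2 * M * (r - a)) expR).
  by apply: cvgM; [exact: cvg_cst|apply: cvgB; [exact: cvg_id|exact: cvg_cst]].
exact: continuous_expR.
Qed.

Lemma Rint_expR (a s K M : R) : 0 < M -> a <= s ->
  \int[mu]_(r in `[a, s]) (M * (K * expR (2 * M * (r - a)))) =
  K / 2 * (expR (2 * M * (s - a)) - 1).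
Proof.
move=> M0; rewrite le_eqVlt => /predU1P[->|as_].
  by rewrite Rint_itv1 subrr mulr0 expR0 subrr mulr0.
pose F r := K / 2 * expR (2 * M * (r - a)).
pose f r := M * (K * expR (2 * M * (r - a))).
have dF r : is_derive r (1 : R) F (f r).
  have -> : f r = K / 2 *: (expR (2 * M * (r - a)) * (2 * M *: (1 - 0))).
    by rewrite /f /GRing.scale/= subr0 mulr1; field.
  by apply: is_deriveZ.
have cf : continuous f.
  exact: continuous_weight.
have cF : continuous F.
  by move=> r; apply: differentiable_continuous; apply/derivable1_diffP; case: (dF r).
rewrite /Rintegral (@continuous_FTC2 _ f F a s as_); last 3 first.
- exact: continuous_subspaceT.
- split.
  + by move=> r _; case: (dF r).
  + by apply: cvg_at_right_filter; exact: cF.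
  + by apply: cvg_at_left_filter; exact: cF.
- by move=> r _; rewrite derive1E; case: (dF r).
by rewrite -EFinB /= /F subrr mulr0 expR0; ring.
Qed.

(* With the weight [expR (2 * M * (s - a))], integrating a term of size [M * xi] halves
   the norm; both Gronwall's lemma and the Picard iteration rest on this. *)
Lemma weighted_Rint_bound (a s K M : R) f : 0 < M -> 0 <= K -> a <= s ->
  bounded_measurable `[a, s] f ->
  (forall r, a <= r <= s -> `|f r| <= M * (K * expR (2 * M * (r - a)))) ->
  `|\int[mu]_(r in `[a, s]) f r| <= K / 2 * expR (2 * M * (s - a)).
Proof.
move=> M0 K0 as_ bf fK; have If := bounded_measurable_integrable bf.
apply: le_trans (le_normr_Rintegral _ If) _ => //.
apply: le_trans (_ : \int[mu]_(r in `[a, s]) (M * (K * expR (2 * M * (r - a)))) <= _).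
  apply: le_Rintegral => //; first exact: integrable_norm.
  apply: bounded_measurable_integrable.
  apply: within_continuous_bounded_measurable; apply: continuous_subspaceT.
  exact: continuous_weight.
by rewrite Rint_expR// mulrBr mulr1; lra.
Qed.

Variables (n : nat) (a b : R) (A : R -> 'M[R]_n).
Hypothesis bA : bounded_measurable_mx `[a, b] A.

Let A_bound : exists2 M : R, 0 < M & forall (K : R) (v : 'cV[R]_n) r i, a <= r <= b ->
  (forall j, `|v j 0| <= K) -> `|(A r *m v) i 0| <= M * K.
Proof.
have [C C0 AC] := bounded_measurable_mx_bound bA.
(* Adding [1] keeps the constant positive when [n] is [0]. *)
exists (n%:R * C + 1); first by rewrite ltr_wpDl// mulr_ge0// ltW.
move=> K v r i rab vK; apply: le_trans (_ : n%:R * C * K <= _).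
  by apply: mulmx_bound => // i' j; exact: AC.
by rewrite mulrDl mul1r lerDl (le_trans _ (vK i)).
Qed.

(** Substituting an a priori bound [K0] on [p] into the equation improves it: the weighted bound
    [2 * e + K0 / 2 ^+ k] becomes [2 * e + K0 / 2 ^+ k.+1], and only [2 * e] survives. The constant,
    twice the largest weight, is chosen before [e], [p] and [q], so a tolerance can be fixed before
    the trajectory is built. *)
Lemma gronwall_linear : exists2 C : R, 0 < C & forall (e : R) (p q : R -> 'cV[R]_n),
  0 <= e -> bounded_measurable_mx `[a, b] p ->
  (forall s i, a <= s <= b -> `|q s i 0| <= e) ->
  (forall s i, a <= s <= b ->
    p s i 0 = q s i 0 + \int[mu]_(r in `[a, s]) (A r *m p r) i 0) ->
  forall s i, a <= s <= b -> `|p s i 0| <= C * e.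
Proof.
have [M M0 AM] := A_bound.
exists (2 * expR (2 * M * (b - a))); first by rewrite mulr_gt0 ?expR_gt0.
move=> e p q e0 bp qe pE s i sab.
have [K0 K0p pK0] := bounded_measurable_mx_bound bp.
pose w r := expR (2 * M * (r - a)).
have w1 r : a <= r -> 1 <= w r.
  by move=> ar; rewrite -expR0 ler_expR mulr_ge0 ?subr_ge0// mulr_ge0// ltW.
have pk k : forall r j, a <= r <= b -> `|p r j 0| <= (2 * e + K0 / 2 ^+ k) * w r.
  elim: k => [|k IH] r j rab.
    rewrite expr0 divr1; apply: le_trans (pK0 _ _ _ _) _ => //.
    have wr := w1 r _; apply: le_trans (_ : (2 * e + K0) * 1 <= _); first lra.
    by rewrite ler_wpM2l//; [lra|apply: wr; lra].
  have Kk : 0 <= 2 * e + K0 / 2 ^+ k.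
    by rewrite addr_ge0 ?mulr_ge0 ?divr_ge0 ?exprn_ge0// ltW.
  have H := @weighted_Rint_bound a r (2 * e + K0 / 2 ^+ k) M
    (fun r => (A r *m p r) j 0) M0 Kk.
  rewrite pE//; apply: le_trans (ler_normD _ _) _.
  apply: le_trans (lerD (qe _ _ rab) (H _ _ _)) _.
  - lra.
  - have rb : `[a, r] `<=` `[a, b] by apply: subset_segment; lra.
    apply: (bounded_measurableS _ rb) => //.
    exact: bounded_measurable_mxM.
  - move=> r' r'ab; apply: AM => [|k']; first lra.
    by apply: IH; lra.
  rewrite -/(w r) exprS invfM.
  have : e <= e * w r by rewrite ler_peMr//; apply: w1; lra.
  by nra.
apply: le_trans (_ : 2 * e * w s <= _).
  apply: (@ler_addgeo _ _ _ (K0 * w s)) => k.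
  by apply: le_trans (pk k s i sab) _; rewrite mulrDl [K0 / _ * _]mulrAC.
rewrite mulrAC ler_wpM2r// ler_pM2l// ler_expR ler_pM2l ?mulr_gt0//; lra.
Qed.

Lemma Rint_lipschitz (c : R) f : bounded_measurable `[a, b] f ->
  exists2 L : R, 0 < L & forall x y, a <= x -> x <= y -> y <= b ->
  `|(c + \int[mu]_(r in `[a, y]) f r) - (c + \int[mu]_(r in `[a, x]) f r)| <=
  L * (y - x).
Proof.
move=> bf; have [_ [L fL]] := bf.
exists (`|L| + 1); first by rewrite ltr_wpDl.
move=> x y ax xy yb.
have bfy : bounded_measurable `[a, y] f.
  by apply: bounded_measurableS bf => //; apply: subset_segment; lra.
rewrite (Rint_split ax xy bfy).
rewrite [X in `|X|](_ : _ = \int[mu]_(r in `[x, y]) f r); last ring.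
apply: Rint_le_bound => //.
  by apply: bounded_measurableS bfy => //; apply: subset_segment; lra.
move=> r rxy; apply: le_trans (fL _ _) _; first by rewrite /= in_itv/=; lra.
by have := ler_norm L; lra.
Qed.

(** Picard iteration from [0]. The differences of successive iterates halve in the weighted norm, so
    the iterates converge geometrically on the whole segment at once. *)
Lemma linear_equation_solvable (f : R -> 'cV[R]_n) (x : 'cV[R]_n) :
  bounded_measurable_mx `[a, b] f ->
  exists2 xi : R -> 'cV[R]_n, {within `[a, b], continuous xi} &
    forall s, a <= s <= b -> forall i, xi s i 0 =
      x i 0 + \int[mu]_(r in `[a, s]) (A r *m xi r + f r) i 0.
Proof.
move=> bf; have [M M0 AM] := A_bound.
pose G (xi : R -> 'cV[R]_n) s : 'cV[R]_n :=
  \col_i (x i 0 + \int[mu]_(r in `[a, s]) (A r *m xi r + f r) i 0).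
have bAf xi : bounded_measurable_mx `[a, b] xi ->
    bounded_measurable_mx `[a, b] (fun r => A r *m xi r + f r).
  by move=> bxi; apply: bounded_measurable_mxD => //; exact: bounded_measurable_mxM.
have cG xi : bounded_measurable_mx `[a, b] xi -> {within `[a, b], continuous (G xi)}.
  move=> bxi; have H i := Rint_lipschitz (x i 0) (bAf _ bxi i 0).
  have /choice[L HL] : forall i, exists L : R, 0 < L /\
    forall x0 y, a <= x0 -> x0 <= y -> y <= b ->
    `|(x i 0 + \int[mu]_(r in `[a, y]) (A r *m xi r + f r) i 0) -
      (x i 0 + \int[mu]_(r in `[a, x0]) (A r *m xi r + f r) i 0)| <= L * (y - x0).
    by move=> i; have [L ? ?] := H i; exists L.
  apply: (@lipschitz_within_continuous_mx _ _ _ _ _ _ (\sum_i L i)) => i j u v au uv vb.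
  rewrite !mxE; apply: le_trans ((HL i).2 _ _ au uv vb) _.
  rewrite ler_wpM2r ?subr_ge0// (bigD1 i)//= lerDl sumr_ge0// => k _.
  by have [/ltW] := HL k.
have bG xi : bounded_measurable_mx `[a, b] xi -> bounded_measurable_mx `[a, b] (G xi).
  by move=> bxi; apply: within_continuous_bounded_measurable_mx; exact: cG.
pose X k := iter k G (fun=> 0).
have bX k : bounded_measurable_mx `[a, b] (X k).
  by elim: k => [|k IH]; [exact: bounded_measurable_mx_cst|exact: bG].
pose w r := expR (2 * M * (r - a)).
have w1 r : a <= r -> 1 <= w r.
  by move=> ar; rewrite -expR0 ler_expR mulr_ge0 ?subr_ge0// mulr_ge0// ltW.
have [C C0 XC] := bounded_measurable_mx_bound (bX 1%N).
have cBE (u v : 'cV[R]_n) j : (u - v) j 0 = u j 0 - v j 0 by rewrite !mxE.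
have GB xi xi' s i : a <= s <= b -> bounded_measurable_mx `[a, b] xi ->
    bounded_measurable_mx `[a, b] xi' ->
    G xi s i 0 - G xi' s i 0 = \int[mu]_(r in `[a, s]) (A r *m (xi r - xi' r)) i 0.
  move=> sab bxi bxi'; rewrite !mxE.
  have sS : `[a, s] `<=` `[a, b] by apply: subset_segment; lra.
  rewrite [LHS](_ : _ = \int[mu]_(r in `[a, s]) (A r *m xi r + f r) i 0 -
    \int[mu]_(r in `[a, s]) (A r *m xi' r + f r) i 0); last ring.
  rewrite -RintB.
  - apply: Rint_ext => r _; rewrite mulmxBr !mxE; ring.
  - by apply: (bounded_measurableS _ sS) => //; exact: bAf.
  - by apply: (bounded_measurableS _ sS) => //; exact: bAf.
have bAB xi xi' : bounded_measurable_mx `[a, b] xi ->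
    bounded_measurable_mx `[a, b] xi' ->
    bounded_measurable_mx `[a, b] (fun r => A r *m (xi r - xi' r)).
  by move=> *; apply: bounded_measurable_mxM => //; exact: bounded_measurable_mxB.
have dX k : forall s i, a <= s <= b -> `|X k.+1 s i 0 - X k s i 0| <= C / 2 ^+ k * w s.
  elim: k => [|k IH] s i sab.
    rewrite expr0 divr1 [X 0%N s i 0]mxE subr0.
    apply: le_trans (XC s i 0 _) _ => //.
    by rewrite ler_peMr ?(ltW C0)//; apply: w1; lra.
  have sS : `[a, s] `<=` `[a, b] by apply: subset_segment; lra.
  have -> : X k.+2 s i 0 - X k.+1 s i 0 =
    \int[mu]_(r in `[a, s]) (A r *m (X k.+1 r - X k r)) i 0.
    exact: GB (bX k.+1) (bX k).
  apply: le_trans (@weighted_Rint_bound _ _ (C / 2 ^+ k) M _ M0 _ _ _ _) _.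
  - by rewrite divr_ge0 ?exprn_ge0// ltW.
  - lra.
  - by apply: (bounded_measurableS _ sS) => //; apply: bAB; exact: bX.
  - move=> r rab; apply: AM => [|j]; first lra.
    by rewrite cBE; apply: IH; lra.
  by rewrite exprS invfM mulrAC -!mulrA (mulrC 2^-1) !mulrA.
(* The weight is replaced by its maximum [w b], which makes the rate uniform in [s]. *)
have {}dX k s i : a <= s <= b -> `|X k.+1 s i 0 - X k s i 0| <= C * w b / 2 ^+ k.
  move=> sab; apply: le_trans (dX k s i sab) _.
  rewrite mulrAC ler_wpM2r ?invr_ge0 ?exprn_ge0// ler_pM2l// ler_expR.
  by rewrite ler_pM2l ?mulr_gt0//; lra.
(* Membership in the segment sits under the existential so that [choice] returns a total function;
   the value off the segment is arbitrary. *)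
have lX s i : exists l, a <= s <= b ->
    forall k, `|X k s i 0 - l| <= 2 * (C * w b) / 2 ^+ k.
  case: (boolP (a <= s <= b)) => sab; last by exists 0.
  have [l Hl] := geometric_limit (fun k => dX k s i sab).
  by exists l => _ k; exact: Hl.
have /choice[xi0 Hxi0] : forall s, exists v : 'cV[R]_n, a <= s <= b ->
    forall i k, `|X k s i 0 - v i 0| <= 2 * (C * w b) / 2 ^+ k.
  move=> s; have /choice[l Hl] := lX s.
  by exists (\col_i l i) => sab i k; rewrite mxE; exact: Hl.
set K := 2 * (C * w b) in Hxi0.
have K0 : 0 <= K by rewrite !mulr_ge0 ?expR_ge0// ltW.
have bxi0 : bounded_measurable_mx `[a, b] xi0.
  move=> i j; rewrite ord1; split.
    apply: (@measurable_fun_cvg _ _ _ _ (fun k s => X k s i 0)).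
      by move=> k; case: (bX k i 0).
    move=> s sab; apply/cvgrPdist_le => e e0; near=> k.
    rewrite distrC; apply: le_trans (Hxi0 s sab i k) _.
    rewrite ler_pdivrMr ?exprn_gt0// -ler_pdivrMl// mulrC.
    apply: le_trans (_ : k%:R <= _); last by rewrite -natrX ler_nat ltnW// ltn_expl.
    near: k; exact: nbhs_infty_ger.
  exists (0 + K) => s sab; have := Hxi0 s sab i 0%N.
  by rewrite expr0 divr1 mxE sub0r normrN add0r.
(* [xi0] is within [K / 2 ^+ k.+1] of [X k.+1], which is [G (X k)] and thus within
   [M * K * (b - a) / 2 ^+ k] of [G xi0]; both errors vanish as [k] grows. *)
have xi0E s i : a <= s <= b -> xi0 s i 0 = G xi0 s i 0.
  move=> sab; apply/eqP; rewrite -subr_eq0 -normr_le0.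
  apply: (@ler_addgeo _ _ _ (K + M * K * (b - a))) => k; rewrite add0r.
  have sS : `[a, s] `<=` `[a, b] by apply: subset_segment; lra.
  rewrite (_ : xi0 s i 0 - _ = - (X k.+1 s i 0 - xi0 s i 0) +
    (X k.+1 s i 0 - G xi0 s i 0)); last ring.
  apply: le_trans (ler_normD _ _) _; rewrite normrN mulrDl lerD//.
    apply: le_trans (Hxi0 s sab i k.+1) _.
    rewrite ler_wpM2l// lef_pV2 ?posrE ?exprn_gt0// exprS ler_peMl ?exprn_ge0//; lra.
  have -> : X k.+1 s i 0 - G xi0 s i 0 =
    \int[mu]_(r in `[a, s]) (A r *m (X k r - xi0 r)) i 0.
    exact: GB (bX k) bxi0.
  apply: le_trans (@Rint_le_bound _ _ _ _ (M * (K / 2 ^+ k)) _ _ _) _; first lra.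
  - by apply: (bounded_measurableS _ sS) => //; apply: bAB.
  - move=> r rab; apply: AM => [|j]; first lra.
    by rewrite cBE; apply: Hxi0; lra.
  rewrite [leRHS]mulrAC -[M * K / _]mulrA; apply: ler_wpM2l; last lra.
  by rewrite mulr_ge0 ?divr_ge0 ?exprn_ge0// ltW.
(* The limit [xi0] is so far only bounded and measurable; [G xi0] equals it on the segment and is
   already known to be continuous. *)
exists (G xi0); first exact: cG.
move=> s sab i; rewrite mxE; congr (_ + _).
apply: Rint_ext => r rs; congr (((A r *m _) + _) i 0).
by apply/colP => j; apply: xi0E; lra.
Unshelve. all: by end_near. Qed.

End linear_equations.

(** * Delayed responses to a strategy *)

Section selection.
Context {R : realType}.
Implicit Types (D : set R).

Lemma compact_entry_bound p (V : set 'cV[R]_p) : compact V ->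
  exists2 C : R, 0 < C & forall v j, V v -> `|v j 0| <= C.
Proof.
move=> /compact_bounded[M [_ VM]]; exists (`|M| + 1); first by rewrite ltr_wpDl.
move=> v j Vv; apply: le_trans (VM (`|M| + 1) _ v Vv).
  by rewrite [leRHS]/Num.Def.normr /= mx_normrE; exact: (le_bigmax _ _ (j, 0)).
by have := ler_norm M; lra.
Qed.

Lemma compact_finite_net p (V : set 'cV[R]_p) (e : R) : compact V -> 0 < e ->
  exists2 s : seq 'cV[R]_p, {in s, forall v, V v} &
    forall u, V u -> exists2 v, v \in s & forall j, `|(v - u) j 0| <= e.
Proof.
rewrite compact_cover => cV e0.
(* Covers consist of open sets, hence the interiors. Balls of column vectors are entrywise, so the
   net is fine in the maximum norm. *)
have [] := cV _ V (fun v => (ball v e)^°).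
- by move=> v _; exact: open_interior.
- move=> v Vv; exists v => //.
  exact: nbhsx_ballx.
move=> s sV Vs; exists (finmap.enum_fset s).
  by move=> v /sV; rewrite inE.
move=> u /Vs[v /= vs /interior_subset [_ vu]]; exists v => // j.
by rewrite !mxE ltW//; exact: (vu j 0).
Qed.

(** Only finitely many comparisons are made, which keeps the choice measurable in [B] and [w]; [u0]
    is the default when no point of [s] passes the test. *)
Definition first_preimage n m (u0 : 'cV[R]_m) (s : seq 'cV[R]_m) (e : R)
    (B : 'M[R]_(n, m)) (w : 'cV[R]_n) : 'cV[R]_m :=
  foldr (fun v u => if \sum_i `|(B *m v - w) i 0| <= e then v else u) u0 s.

Lemma bounded_measurable_if D (c : R -> bool) f g : measurable D ->
  measurable_fun D c -> bounded_measurable D f -> bounded_measurable D g ->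
  bounded_measurable D (fun x => if c x then f x else g x).
Proof.
move=> mD mc [mf [M fM]] [mg [N gN]]; split.
  apply: measurable_fun_if => //.
  - by apply: measurable_funS mf => //; exact: subIsetl.
  - by apply: measurable_funS mg => //; exact: subIsetl.
exists (`|M| + `|N|) => x Dx.
have := fM x Dx; have := gN x Dx; have := ler_norm M; have := ler_norm N.
have := normr_ge0 M; have := normr_ge0 N.
by case: ifP => _; lra.
Qed.

Lemma first_preimage_bounded_measurable n m u0 s e D (B : R -> 'M[R]_(n, m))
    (w : R -> 'cV[R]_n) : measurable D ->
  bounded_measurable_mx D B -> bounded_measurable_mx D w ->
  bounded_measurable_mx D (fun r => first_preimage u0 s e (B r) (w r)).
Proof.
move=> mD bB bw i j; elim: s => [|v s IH] /=; first exact: bounded_measurable_cst.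
rewrite (_ : (fun _ => _) = fun r => if \sum_i `|(B r *m v - w r) i 0| <= e then v i j
  else first_preimage u0 s e (B r) (w r) i j); last by apply/funext => r; case: ifP.
apply: bounded_measurable_if => //; last exact: bounded_measurable_cst.
apply: measurable_fun_ler; last exact: measurable_cst.
apply: measurable_sum => k; apply: measurableT_comp => //.
have H : bounded_measurable_mx D (fun r => B r *m v - w r).
  apply: bounded_measurable_mxB => //; apply: bounded_measurable_mxM => //.
  exact: bounded_measurable_mx_cst.
by case: (H k 0).
Qed.

(** [S] is fixed before [w], because its target will involve a disturbance known only once the
    strategy has answered. It picks from a net of [U] so fine that [B] turns its mesh into an error
    of at most [e]. *)
Lemma approximate_selection n m (D : set R) (B : R -> 'M[R]_(n, m))
    (U : set 'cV[R]_m) (u0 : 'cV[R]_m) (e : R) :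
  measurable D -> bounded_measurable_mx D B -> compact U -> U u0 -> 0 < e ->
  exists S : R -> 'cV[R]_n -> 'cV[R]_m, [/\
    forall r w, U (S r w),
    forall w, bounded_measurable_mx D w ->
      bounded_measurable_mx D (fun r => S r (w r)) &
    forall r w i, D r -> mimage (B r) U w -> `|(B r *m S r w - w) i 0| <= e].
Proof.
move=> mD bB cU Uu0 e0.
have [C C0 BC] := bounded_measurable_mx_bound bB.
(* The product bounds the sum of the moduli of the entries of [B r *m v] when those of [v] are at
   most [1]; the added [1] allows division by [K]. *)
pose K := n%:R * (m%:R * C) + 1.
have K0 : 0 < K by rewrite ltr_wpDl// !mulr_ge0// ltW.
have [s sU Us] := compact_finite_net cU (divr_gt0 e0 K0).
exists (fun r w => first_preimage u0 s e (B r) w); split.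
- move=> r w; elim: s sU {Us} => [|v s IH] sU //=.
  case: ifP => _; first by apply: sU; rewrite mem_head.
  by apply: IH => v' vs; apply: sU; rewrite in_cons vs orbT.
- by move=> w bw; exact: first_preimage_bounded_measurable.
- move=> r w i Dr [u Uu <-].
  have [v vs vu] := Us u Uu.
  have Pv : \sum_i `|(B r *m v - B r *m u) i 0| <= e.
    apply: le_trans (_ : \sum_(i < n) m%:R * C * (e / K) <= _).
      apply: ler_sum => k _; rewrite -mulmxBr; apply: mulmx_bound => //.
      by move=> i' j; exact: BC.
    rewrite sumr_const card_ord -[leLHS]mulr_natl mulrA mulrCA ler_piMr ?(ltW e0)//.
    by rewrite ler_pdivrMr// mul1r /K; lra.
  have : \sum_i `|(B r *m first_preimage u0 s e (B r) (B r *m u) - B r *m u) i 0| <= e.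
    elim: s vs {sU Us} => //= v' s IH; rewrite in_cons.
    case: ifPn => // nP /predU1P[vv'|vs]; last exact: IH.
    by rewrite -vv' Pv in nP.
  apply: le_trans; rewrite (bigD1 i)//= lerDl sumr_ge0//.
Qed.

(** Delayed times leave the segment, so functions are extended to the line before being
    translated. *)
Lemma bounded_measurable_extend (a b c : R) f : bounded_measurable `[a, b] f ->
  bounded_measurable [set: R] (fun r => if a <= r <= b then f r else c).
Proof.
move=> [mf [M fM]]; split.
  apply: measurable_fun_if => //.
  - apply: measurable_and; apply: measurable_fun_ler => //; exact: measurable_cst.
  - apply: measurable_funS mf => // x /= [_]; by rewrite in_itv.
exists (`|M| + `|c|) => x _; case: ifP => [xab|_]; last by rewrite lerDr.
apply: le_trans (fM x xab) _; have := ler_norm M; have := normr_ge0 c; lra.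
Qed.

End selection.

(** * The delayed control and the cost of the delay *)

Section delay.
Context {R : realType}.
Notation mu := (@lebesgue_measure R).

(** Method of steps: [F u] at time [s] reads the answer to [u] only at [s - h], so agreement of two
    successive iterates up to some time propagates by [h]. The formula for [u] holds at every [s],
    while [delta u] and [d] agree only almost everywhere, as non-anticipativity provides. *)
Lemma delayed_fixpoint m l (t T h : R) (U : set 'cV[R]_m) (D : set 'cV[R]_l)
    (delta : (R -> 'cV[R]_m) -> (R -> 'cV[R]_l)) (sigma : R -> 'cV[R]_l -> 'cV[R]_m)
    (u0 : 'cV[R]_m) :
  t <= T -> 0 < h -> nonanticipative t T U D delta -> U u0 ->
  (forall r d, U (sigma r d)) ->
  (forall d, admissible t T (fun=> D) d ->
    bounded_measurable_mx `[t, T] (fun r => sigma r (d r))) ->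
  exists u d, [/\ admissible t T (fun=> U) u, admissible t T (fun=> D) d,
    forall s, u s = if t <= s - h <= T then sigma (s - h) (d (s - h)) else u0 &
    {ae mu, forall r, t <= r <= T -> delta u r = d r}].
Proof.
move=> tT h0 [dD dna] Uu0 sU bs.
pose F u s := if t <= s - h <= T then sigma (s - h) (delta u (s - h)) else u0.
have aF u : admissible t T (fun=> U) u -> admissible t T (fun=> U) (F u).
  move=> au; split; last by move=> s _; rewrite /F; case: ifP.
  move=> i; have H := bounded_measurable_extend (u0 i 0) (bs _ (dD _ au) i 0).
  apply: measurable_funTS.
  rewrite (_ : (fun _ => _) = (fun r => if t <= r <= T then sigma r (delta u r) i 0
    else u0 i 0) \o (fun s => s - h)).
    by apply: measurableT_comp; [case: H|exact: measurable_translation].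
  by apply/funext => s; rewrite /F /=; case: ifP.
pose u_ k := iter k F (fun=> u0).
have au k : admissible t T (fun=> U) (u_ k).
  by elim: k => [|k IH]; [split => // i; exact: measurable_cst|exact: aF].
(* The time is capped at [T] because non-anticipativity is stated for times in [[t, T]]. *)
have step k (r0 := Num.min (t + k%:R * h) T) :
    {ae mu, forall r, t <= r <= r0 -> u_ k.+1 r = u_ k r} ->
    {ae mu, forall r, t <= r <= r0 -> delta (u_ k.+1) r = delta (u_ k) r}.
  apply: dna; rewrite /r0; last 2 first; try exact: au.
  by rewrite le_min tT lerDl mulr_ge0 ?(ltW h0)//= ge_min lexx orbT.
(* Each iteration settles the control on one more interval of length [h]. *)
have agree k : {ae mu, forall r, t <= r <= Num.min (t + k%:R * h) T ->
    u_ k.+1 r = u_ k r}.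
  elim: k => [|k /step IH].
    (* For [k = 0] the segment is the single point [t], a null set. *)
    apply: (@ae_neq _ _ t) => r rt.
    rewrite mul0r addr0 le_min => /andP[tr /andP[rt' _]].
    by move: rt; rewrite eq_le tr rt'.
  apply: ae_imp (ae_translation h IH) => r IHr.
  rewrite le_min => /andP[tr /andP[rk rT]].
  change (F (u_ k.+1) r = F (u_ k) r); rewrite /F; case: ifP => // trh.
  rewrite IHr// le_min; move: rk; rewrite -natr1; lra.
have [k kT] : exists k : nat, T <= t + k%:R * h.
  exists (Num.bound `|(T - t) / h|).
  have := archi_boundP (normr_ge0 ((T - t) / h)); set N := _%:R => HN.
  have : (T - t) / h <= N by apply: le_trans (ler_norm _) (ltW HN).
  by rewrite ler_pdivrMr//; lra.
(* Since [u_ k.+1] is [F (u_ k)] by definition, its formula holds with [d] equal to [delta (u_ k)];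
   the two iterates agree up to [T], hence so do the answers to them. *)
exists (u_ k.+1), (delta (u_ k)); split => //.
- exact: dD.
- apply: ae_imp (step k (agree k)) => r Hr rT; apply: Hr; rewrite le_min; lra.
Qed.

(** With [f] standing for [B v], the integrand is split into [B r *m v (r - h) - f (r - h)],
    [f (r - h) - f r] and [f r - z r]. The first is controlled by [o] except on an initial stretch
    of length [h], the second integrates to two end pieces of length [h], the third is at most [e].
    The two boundary effects cost [2 * Q * h] each, whence the factor [4]. *)
Lemma delayed_Rint_bound n m (a b h C K o e : R) (B : R -> 'M[R]_(n, m))
    (v : R -> 'cV[R]_m) (z : R -> 'cV[R]_n) :
  0 < h -> bounded_measurable_mx `[a, b] B -> bounded_measurable_mx [set: R] v ->
  bounded_measurable_mx `[a, b] z ->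
  (forall r i j, a <= r <= b -> `|B r i j| <= C) ->
  (forall r j, `|v r j 0| <= K) ->
  (forall r r' i j, a <= r <= b -> a <= r' <= b -> `|r - r'| <= h ->
    `|(B r - B r') i j| <= o) ->
  (forall r i, a <= r <= b -> `|(B r *m v r - z r) i 0| <= e) ->
  forall s i, a <= s <= b ->
  `|\int[mu]_(r in `[a, s]) (B r *m v (r - h) - z r) i 0| <=
    (m%:R * o * K + e) * (b - a) + 4 * (m%:R * C * K) * h.
Proof.
move=> h0 bB bv bz BC vK Bo Be s i sab.
pose f r := if a <= r <= b then (B r *m v r) i 0 else 0.
have cBE (u w : 'cV[R]_n) : (u - w) i 0 = u i 0 - w i 0 by rewrite !mxE.
have bvab : bounded_measurable_mx `[a, b] v by exact: bounded_measurable_mxS bv.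
have bf : bounded_measurable [set: R] f.
  apply: bounded_measurable_extend; exact: bounded_measurable_mxM.
have bvh : bounded_measurable_mx [set: R] (fun r => v (r - h)).
  by move=> k j; apply: bounded_measurable_translation (bv k j).
have bfh := bounded_measurable_translation h bf.
have BvK r r' : a <= r <= b -> `|(B r *m v r') i 0| <= m%:R * C * K.
  by move=> rab; apply: mulmx_bound => // i' j; exact: BC.
set Q := m%:R * C * K in BvK *.
have Q0 : 0 <= Q by apply: le_trans (normr_ge0 _) (BvK s s sab).
have fQ r : `|f r| <= Q by rewrite /f; case: ifP => [/BvK//|_]; rewrite normr0.
have S1 x y : a <= x -> y <= b -> `[x, y] `<=` `[a, b] by exact: subset_segment.
have bT x y g : bounded_measurable [set: R] g -> bounded_measurable `[x, y] g.
  by move=> bg; exact: bounded_measurableS bg.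
pose g r := (B r *m v (r - h)) i 0.
have bg x y : a <= x -> y <= b -> bounded_measurable `[x, y] g.
  move=> ax yb; apply: (bounded_measurableS _ (S1 _ _ ax yb)) => //.
  apply: bounded_measurable_mxM => //; exact: bounded_measurable_mxS bvh.
have bz' x y : a <= x -> y <= b -> bounded_measurable `[x, y] (fun r => z r i 0).
  by move=> ax yb; apply: (bounded_measurableS _ (S1 _ _ ax yb)) => //; exact: bz.
have [as_ sb] := andP sab.
have -> : \int[mu]_(r in `[a, s]) (B r *m v (r - h) - z r) i 0 =
    \int[mu]_(r in `[a, s]) (g r - f (r - h)) +
    (\int[mu]_(r in `[a, s]) f (r - h) - \int[mu]_(r in `[a, s]) f r) +
    \int[mu]_(r in `[a, s]) (f r - z r i 0).
  rewrite !RintB//; try exact: bT; try exact: bg; try exact: bz'.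
  rewrite (@Rint_ext _ _ _ (fun r => (B r *m v (r - h) - z r) i 0)
    (fun r => g r - z r i 0)); last first.
    by move=> r _; rewrite cBE.
  by rewrite RintB; [ring|exact: bg|exact: bz'].
have I3 : `|\int[mu]_(r in `[a, s]) (f r - z r i 0)| <= e * (s - a).
  apply: Rint_le_bound => //.
    by apply: bounded_measurableB; [exact: bT|exact: bz'].
  move=> r ras; have rab : a <= r <= b by lra.
  by rewrite /f rab -cBE; exact: Be.
have e0 : 0 <= e by apply: le_trans (normr_ge0 _) (Be s i sab).
have I2 : `|\int[mu]_(r in `[a, s]) f (r - h) -
    \int[mu]_(r in `[a, s]) f r| <= 2 * Q * h.
  rewrite Rint_translation//.
  (* Splitting [[a - h, s]] at [a] and at [s - h] leaves only the integrals over [[a - h, a]] and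
     [[s - h, s]]. *)
  have E1 := @Rint_split _ (a - h) a s f _ as_ (bT _ _ _ bf).
  have E2 := @Rint_split _ (a - h) (s - h) s f _ _ (bT _ _ _ bf).
  have {}E1 := E1 ltac:(lra); have {}E2 := E2 ltac:(lra) ltac:(lra).
  rewrite E1 in E2.
  have L1 := @Rint_le_bound _ (a - h) a f Q ltac:(lra) (bT _ _ _ bf) (fun r _ => fQ r).
  have L2 := @Rint_le_bound _ (s - h) s f Q ltac:(lra) (bT _ _ _ bf) (fun r _ => fQ r).
  rewrite (_ : a - (a - h) = h) in L1; last ring.
  rewrite (_ : s - (s - h) = h) in L2; last ring.
  move: L1 L2; rewrite !ler_norml; lra.
have bgf x y : a <= x -> y <= b ->
    bounded_measurable `[x, y] (fun r => g r - f (r - h)).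
  by move=> ax yb; apply: bounded_measurableB; [exact: bg|exact: bT].
have gf2 r : a <= r <= b -> `|g r - f (r - h)| <= 2 * Q.
  move=> rab; apply: le_trans (ler_normB _ _) _.
  by have := BvK r (r - h) rab; have := fQ (r - h); rewrite /g; lra.
have o0 : 0 <= m%:R * o * K.
  apply: le_trans (normr_ge0 (((B s - B s) *m v s) i 0)) _.
  by apply: mulmx_bound => // i' j; apply: Bo => //; rewrite subrr normr0 ltW.
have I1 : `|\int[mu]_(r in `[a, s]) (g r - f (r - h))| <=
    m%:R * o * K * (b - a) + 2 * Q * h.
  (* Before [a + h] the delayed time precedes [a], and the crude bound [2 * Q] is used; after it the
     modulus [o] applies. *)
  have [sh|hs] := leP s (a + h).
    apply: le_trans (@Rint_le_bound _ _ _ _ (2 * Q) as_ (bgf _ _ _ _) _) _ => //.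
      by move=> r ras; apply: gf2; lra.
    have : 2 * Q * (s - a) <= 2 * Q * h by apply: ler_wpM2l; lra.
    have : 0 <= m%:R * o * K * (b - a) by apply: mulr_ge0 => //; lra.
    lra.
  rewrite (@Rint_split _ a (a + h) s); [|lra|lra|exact: bgf].
  have L1 : `|\int[mu]_(r in `[a, a + h]) (g r - f (r - h))| <= 2 * Q * (a + h - a).
    apply: Rint_le_bound; [lra|apply: bgf; lra|].
    by move=> r ras; apply: gf2; lra.
  have L2 : `|\int[mu]_(r in `[a + h, s]) (g r - f (r - h))| <=
      m%:R * o * K * (s - (a + h)).
    apply: Rint_le_bound; [lra|apply: bgf; lra|].
    move=> r ras; have rh : a <= r - h <= b by lra.
    rewrite /g /f rh -cBE -mulmxBl; apply: mulmx_bound => // i' j.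
    by apply: Bo; [lra|lra|rewrite (_ : r - _ = h); [rewrite gtr0_norm|ring]].
  rewrite (_ : a + h - a = h) in L1; last ring.
  have : m%:R * o * K * (s - (a + h)) <= m%:R * o * K * (b - a).
    by apply: ler_wpM2l; lra.
  move=> L3; apply: le_trans (ler_normD _ _) _; lra.
have L3 : e * (s - a) <= e * (b - a) by apply: ler_wpM2l; lra.
apply: le_trans (ler_normD _ _) _.
apply: le_trans (lerD (ler_normD _ _) I3) _; rewrite mulrDl; lra.
Qed.

End delay.

(** * Steering against a strategy towards a prescribed trajectory *)

Section steering.
Context {R : realType}.
Notation mu := (@lebesgue_measure R).

Lemma within_continuous_unif_mx p q (a b e : R) (F : R -> 'M[R]_(p, q)) :
  {within `[a, b], continuous F} -> 0 < e -> exists2 d : R, 0 < d &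
    forall x y i j, a <= x <= b -> a <= y <= b -> `|x - y| < d ->
      `|(F x - F y) i j| <= e.
Proof.
move=> cF e0.
have : \forall d \near (0 : R)^'+, forall ij : 'I_p * 'I_q, forall x y,
    a <= x <= b -> a <= y <= b -> `|x - y| < d -> `|(F x - F y) ij.1 ij.2| <= e.
  apply: filter_forall => -[i j].
  have [d d0 dF] :=
    within_continuous_unif (@within_continuous_entry _ _ _ _ _ i j cF) e0.
  near=> d' => x y xab yab xy; rewrite !mxE; apply: dF => //.
  by apply: lt_trans xy _; near: d'; exact: nbhs_right_lt.
move=> [d /= d0 H]; exists (d / 2); first by rewrite divr_gt0.
move=> x y i j xab yab xy; apply: (H (d / 2) _ _ (i, j)) => //=.
- by rewrite sub0r normrN gtr0_norm; lra.
- lra.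
Unshelve. all: by end_near. Qed.

Lemma admissible_bounded_measurable p (a b : R) (V : set 'cV[R]_p) u : compact V ->
  admissible a b (fun=> V) u -> bounded_measurable_mx `[a, b] u.
Proof.
move=> /compact_entry_bound[C C0 VC] [mu_ uV] i j; rewrite ord1; split => //.
by exists C => s sab; apply: VC; exact: uV.
Qed.

(** Any fixed [d] in [D] writes [w s] as [B s *m u + E s *m d] with [u] in [U], which bounds it
    uniformly. *)
Lemma Wset_admissible_bounded_measurable n m l (a b : R) (B : R -> 'M[R]_(n, m))
    (E : R -> 'M[R]_(n, l)) (U : set 'cV[R]_m) (D : set 'cV[R]_l) w :
  bounded_measurable_mx `[a, b] B -> bounded_measurable_mx `[a, b] E ->
  compact U -> D !=set0 -> admissible a b (Wset B E U D) w ->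
  bounded_measurable_mx `[a, b] w.
Proof.
move=> bB bE /compact_entry_bound[C C0 UC] [d Dd] [mw wW] i j; rewrite ord1.
split => //.
have [CB CB0 BC] := bounded_measurable_mx_bound bB.
have bEd : bounded_measurable_mx `[a, b] (fun r => E r *m d).
  by apply: bounded_measurable_mxM => //; exact: bounded_measurable_mx_cst.
have [CE CE0 EC] := bounded_measurable_mx_bound bEd.
exists (m%:R * CB * C + CE) => s sab.
have [|u Uu uE] := wW s sab (w s + (- E s) *m d).
  by exists (w s), ((- E s) *m d); split => //; split => //; exists d.
have -> : w s i 0 = (B s *m u) i 0 + (E s *m d) i 0.
  by rewrite uE mulNmx !mxE; ring.
apply: le_trans (ler_normD _ _) _; apply: lerD; last exact: EC.
by apply: mulmx_bound => [i' j'|k]; [exact: BC|exact: UC].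
Qed.

(** Bounded measurability takes the place of continuity: it suffices for Gronwall's lemma and passes
    at once to linear combinations. *)
Definition forward_solution n (A : R -> 'M[R]_n) (a b : R) (x : 'cV[R]_n)
    (f xi : R -> 'cV[R]_n) :=
  bounded_measurable_mx `[a, b] xi /\
  forall s, a <= s <= b -> forall i, xi s i 0 =
    x i 0 + \int[mu]_(r in `[a, s]) (A r *m xi r + f r) i 0.

Lemma forward_solution_comb n (A : R -> 'M[R]_n) (a b : R) (c c' : R)
    (x x' : 'cV[R]_n) (f f' xi xi' : R -> 'cV[R]_n) :
  bounded_measurable_mx `[a, b] A ->
  bounded_measurable_mx `[a, b] f -> bounded_measurable_mx `[a, b] f' ->
  forward_solution A a b x f xi -> forward_solution A a b x' f' xi' ->
  forward_solution A a b (c *: x + c' *: x') (fun r => c *: f r + c' *: f' r)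
    (fun r => c *: xi r + c' *: xi' r).
Proof.
move=> bA bf bf' [bxi xiE] [bxi' xiE']; split.
  by apply: bounded_measurable_mxD; exact: bounded_measurable_mxZ.
move=> s sab i; rewrite !mxE xiE// xiE'//.
have sS : `[a, s] `<=` `[a, b] by apply: subset_segment; lra.
have b1 : bounded_measurable `[a, s] (fun r => (A r *m xi r + f r) i 0).
  apply: (bounded_measurableS _ sS) => //.
  by apply: bounded_measurable_mxD => //; exact: bounded_measurable_mxM.
have b2 : bounded_measurable `[a, s] (fun r => (A r *m xi' r + f' r) i 0).
  apply: (bounded_measurableS _ sS) => //.
  by apply: bounded_measurable_mxD => //; exact: bounded_measurable_mxM.
rewrite (@Rint_ext _ _ _ (fun r => (A r *m (c *: xi r + c' *: xi' r) +
    (c *: f r + c' *: f' r)) i 0) (fun r => c * (A r *m xi r + f r) i 0 +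
  c' * (A r *m xi' r + f' r) i 0)); last first.
  move=> r _; rewrite mulmxDr -!scalemxAr !mxE; ring.
rewrite RintD; first by rewrite !RintZ//; ring.
- by apply: bounded_measurableM => //; exact: bounded_measurable_cst.
- by apply: bounded_measurableM => //; exact: bounded_measurable_cst.
Qed.

(** The gap [xi - (zeta + phi)] solves the linear equation driven by the primitive of [B u + E
    delta[u] - w], where [phi] carries the initial offset [x - y]. The delay makes that primitive at
    most [eta / G], and Gronwall's lemma multiplies it by [G]. *)
Lemma strategy_steering n m l (t T : R) (A : R -> 'M[R]_n) (B : R -> 'M[R]_(n, m))
    (E : R -> 'M[R]_(n, l)) (U : set 'cV[R]_m) (D : set 'cV[R]_l)
    (delta : (R -> 'cV[R]_m) -> (R -> 'cV[R]_l)) (w zeta phi : R -> 'cV[R]_n)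
    (x y : 'cV[R]_n) (eta : R) :
  t <= T -> {within `[t, T], continuous A} -> {within `[t, T], continuous B} ->
  {within `[t, T], continuous E} -> compact U -> U !=set0 -> compact D ->
  bounded_measurable_mx `[t, T] w ->
  (forall s, t <= s <= T -> Wset B E U D s (w s)) ->
  forward_solution A t T y w zeta ->
  forward_solution A t T (x - y) (fun=> 0) phi ->
  nonanticipative t T U D delta -> 0 < eta ->
  exists u xi, [/\ admissible t T (fun=> U) u, is_traj A B E t T x u (delta u) xi &
    forall i, `|(xi T - (zeta T + phi T)) i 0| <= eta].
Proof.
move=> tT cA cB cE cU [u0 Uu0] cD bw wW [bzeta zetaE] [bphi phiE] dna eta0.
have bA := within_continuous_bounded_measurable_mx cA.
have bB := within_continuous_bounded_measurable_mx cB.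
have bE := within_continuous_bounded_measurable_mx cE.
have [G G0 HG] := gronwall_linear bA.
have [C C0 BC] := bounded_measurable_mx_bound bB.
have [K K0 UK] := compact_entry_bound cU.
(* The bound of [delayed_Rint_bound] with [o] equal to [e] and [h] at most [e] is at most [e * Q];
   the last [1] makes [Q] positive. *)
pose Q := (m%:R * K + 1) * (T - t) + 4 * (m%:R * C * K) + 1.
have Q0 : 0 < Q.
  have ? : 0 <= m%:R * K by rewrite mulr_ge0// ltW.
  have ? : 0 <= m%:R * C * K by rewrite !mulr_ge0// ltW.
  have : 0 <= (m%:R * K + 1) * (T - t) by rewrite mulr_ge0; lra.
  rewrite /Q; lra.
pose e := eta / G / Q.
have e0 : 0 < e by rewrite !divr_gt0.
have [d d0 Bd] := within_continuous_unif_mx cB e0.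
(* Half of [d], since uniform continuity asks for a distance strictly below [d] and the delay
   estimate allows distance [h] itself. *)
pose h := Num.min (d / 2) e.
have h0 : 0 < h by rewrite lt_min e0 divr_gt0.
have hd : h <= d / 2 by rewrite ge_min lexx.
have he : h <= e by rewrite ge_min lexx orbT.
have mtT : measurable (`[t, T]%classic : set R) by [].
have [S [SU bS SB]] := approximate_selection mtT bB cU Uu0 e0.
pose sigma r (dd : 'cV[R]_l) := S r (w r - E r *m dd).
have bz dd : admissible t T (fun=> D) dd ->
    bounded_measurable_mx `[t, T] (fun r => w r - E r *m dd r).
  move=> add; apply: bounded_measurable_mxB => //; apply: bounded_measurable_mxM => //.
  exact: admissible_bounded_measurable add.
have bsigma dd : admissible t T (fun=> D) dd ->
    bounded_measurable_mx `[t, T] (fun r => sigma r (dd r)).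
  by move=> add; apply: bS; exact: bz.
have Usigma r dd : U (sigma r dd) by exact: SU.
have [u [dd [au add uE deltaE]]] :=
  delayed_fixpoint tT h0 dna Uu0 Usigma bsigma.
(* The response before the delay: [u s] is [v (s - h)] at every [s]. *)
pose v r := if t <= r <= T then sigma r (dd r) else u0.
have bv : bounded_measurable_mx [set: R] v.
  move=> i j; rewrite (_ : (fun _ => _) = fun r =>
    if t <= r <= T then sigma r (dd r) i j else u0 i j).
    by apply: bounded_measurable_extend; exact: bsigma.
  by apply/funext => r; rewrite /v; case: ifP.
have Uv r : U (v r) by rewrite /v; case: ifP => // _; exact: SU.
have q_bound s i : t <= s <= T ->
    `|\int[mu]_(r in `[t, s]) (B r *m v (r - h) - (w r - E r *m dd r)) i 0| <= eta / G.
  move=> sab; apply: le_trans (@delayed_Rint_bound _ _ _ t T h C K e e B v _ h0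
    bB bv (bz _ add) _ _ _ _ s i sab) _.
  - by move=> r i' j rab; exact: BC.
  - by move=> r j; apply: UK.
  - by move=> r r' i' j rab r'ab rr'; apply: Bd => //; apply: le_lt_trans rr' _; lra.
  - move=> r i' rab; rewrite /v rab; apply: SB => //.
    have [|u' Uu' u'E] := wW r rab (w r + (- E r) *m dd r).
      exists (w r), ((- E r) *m dd r); split => //; split => //.
      by exists (dd r) => //; exact: add.2.
    by exists u' => //; rewrite u'E mulNmx.
  rewrite (_ : eta / G = e * Q); last by rewrite /e divfK ?gt_eqF.
  rewrite /Q [m%:R * e * K]mulrAC -[X in X + e]mulrC -[X in _ + X]mul1r.
  have : 4 * (m%:R * C * K) * h <= 4 * (m%:R * C * K) * e.
    by apply: ler_wpM2l => //; rewrite !mulr_ge0// ltW.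
  have : e * Q = (e * (m%:R * K) + 1 * e) * (T - t) + 4 * (m%:R * C * K) * e + e.
    rewrite /Q; ring.
  rewrite /Q; lra.
have bu := admissible_bounded_measurable cU au.
have bdu := admissible_bounded_measurable cD (dna.1 u au).
have bf : bounded_measurable_mx `[t, T] (fun r => B r *m u r + E r *m delta u r).
  by apply: bounded_measurable_mxD; exact: bounded_measurable_mxM.
have [xi cxi xiE] := @linear_equation_solvable _ _ _ _ _ bA _ x bf.
have bxi := within_continuous_bounded_measurable_mx cxi.
exists u, xi; split => //.
  split => // s sab i; rewrite xiE// /oint; have [ts _] := andP sab; rewrite ts.
  by congr (_ + _); apply: Rint_ext => r _; rewrite addrA.
move=> i.
have TT : t <= T <= T by lra.
have bzp := bounded_measurable_mxD bzeta bphi.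
have bp := bounded_measurable_mxB bxi bzp.
rewrite (_ : eta = G * (eta / G)); last by rewrite mulrC divfK ?gt_eqF.
apply: (HG (eta / G) _ (fun s => \col_i \int[mu]_(r in `[t, s])
    ((B r *m u r + E r *m delta u r) - w r) i 0) _ bp _ _ T i TT).
- by rewrite divr_ge0// ltW.
- move=> s j sab; rewrite mxE.
  have sS : `[t, s] `<=` `[t, T] by apply: subset_segment; lra.
  rewrite (_ : \int[mu]_(r in _) _ = \int[mu]_(r in `[t, s])
    (B r *m v (r - h) - (w r - E r *m dd r)) j 0).
    exact: q_bound.
  apply: Rint_ae.
  + by apply: (bounded_measurableS _ sS) => //; exact: bounded_measurable_mxB.
  + apply: (bounded_measurableS _ sS) => //.
    apply: bounded_measurable_mxB; last exact: bz.
    apply: bounded_measurable_mxM => //.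
    move=> i' j'.
    exact: bounded_measurableS (bounded_measurable_translation h (bv i' j')).
  + apply: ae_imp deltaE => r Hr rs.
    rewrite Hr; last lra.
    by rewrite uE -/(v (r - h)) opprB addrA.
- move=> s j sab; rewrite [in LHS]mxE [in X in _ + X]mxE [in X in _ + - X]mxE.
  rewrite [in RHS]mxE xiE// zetaE// phiE//.
  have sS : `[t, s] `<=` `[t, T] by apply: subset_segment; lra.
  have bS' (F : R -> 'cV[R]_n) : bounded_measurable_mx `[t, T] F ->
      bounded_measurable `[t, s] (fun r => F r j 0).
    by move=> bF; apply: (bounded_measurableS _ sS) => //; exact: bF.
  have b1 := bS' _ (bounded_measurable_mxB bf bw).
  have b2 := bS' _ (bounded_measurable_mxM bA bp).
  have b3 := bS' _ (bounded_measurable_mxD (bounded_measurable_mxM bA bzeta) bw).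
  have b4 := bS' _ (bounded_measurable_mxD (bounded_measurable_mxM bA bphi)
    (@bounded_measurable_mx_cst _ _ _ _ 0)).
  have -> : \int[mu]_(r in `[t, s])
      (A r *m xi r + (B r *m u r + E r *m delta u r)) j 0 =
      \int[mu]_(r in `[t, s]) ((B r *m u r + E r *m delta u r) - w r) j 0 +
      \int[mu]_(r in `[t, s]) (A r *m (xi r - (zeta r + phi r))) j 0 +
      \int[mu]_(r in `[t, s]) (A r *m zeta r + w r) j 0 +
      \int[mu]_(r in `[t, s]) (A r *m phi r + 0) j 0.
    have b12 := bounded_measurableD b1 b2.
    have b123 := bounded_measurableD b12 b3.
    rewrite -(RintD b1 b2) -(RintD b12 b3) -(RintD b123 b4).
    apply: Rint_ext => r _; rewrite !mulmxBr !mulmxDr !mxE; ring.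
  rewrite !mxE; ring.
Qed.

End steering.

(** * Trajectories of the auxiliary system and convexity of their starting points *)

Section reachability.
Context {R : realType}.
Notation mu := (@lebesgue_measure R).

(** The combination is tested against one [d] at a time, and the two witnesses in [U] for that [d]
    are mixed with the same weights. *)
Lemma Wset_convex n m l (B : R -> 'M[R]_(n, m)) (E : R -> 'M[R]_(n, l)) U D t :
  is_convex_set U -> is_convex_set (Wset B E U D t).
Proof.
move=> cU c c' Wc Wc' lam lam01 _ [_ [_ [-> [[d Dd <-] ->]]]].
have [|u Uu uE] := Wc (c + (- E t) *m d).
  by exists c, ((- E t) *m d); split => //; split => //; exists d.
have [|u' Uu' uE'] := Wc' (c' + (- E t) *m d).
  by exists c', ((- E t) *m d); split => //; split => //; exists d.
exists (lam *: u + (1 - lam) *: u'); first exact: cU.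
rewrite mulmxDr -!scalemxAr uE uE' !scalerDr addrACA -scalerDl.
by rewrite (_ : lam + (1 - lam) = 1) ?scale1r//; ring.
Qed.

(** Subtracting the integrals over [[t, T]] and [[s, T]] moves the anchor of the equation from [T]
    to [t]. *)
Lemma backward_forward_solution n (A : R -> 'M[R]_n) (t T : R) xT w xi :
  0 <= t <= T -> bounded_measurable_mx `[0, T] A -> bounded_measurable_mx `[0, T] w ->
  is_backward_traj A T xT w xi ->
  forward_solution A t T (xi t) w xi /\ xi T = xT.
Proof.
move=> tT bA bw [cxi xiE].
have bxi := within_continuous_bounded_measurable_mx cxi.
have bf := bounded_measurable_mxD (bounded_measurable_mxM bA bxi) bw.
have xiE' s i : 0 <= s <= T ->
    xi s i 0 = xT i 0 - \int[mu]_(r in `[s, T]) (A r *m xi r + w r) i 0.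
  move=> sT; rewrite xiE// /oint; case: ifP => // Ts.
  (* For [s] at most [T], the unsigned branch of [oint T s] occurs only at [s = T], where the
     integral vanishes. *)
  have -> : s = T by lra.
  by rewrite !Rint_itv1 subr0 addr0.
have tS : `[t, T] `<=` `[0, T] by apply: subset_segment; lra.
split; last first.
  by apply/colP => i; rewrite xiE' ?Rint_itv1 ?subr0//; lra.
split; first exact: bounded_measurable_mxS bxi.
move=> s sT i; rewrite !xiE'; try lra.
rewrite (@Rint_split _ t s T); [ring|lra|lra|].
by apply: (bounded_measurableS _ tS) => //; exact: bf.
Qed.

Lemma state_transition_forward_solution n (A : R -> 'M[R]_n) (t T : R) Phi z :
  0 <= t <= T -> bounded_measurable_mx `[0, T] A -> is_state_transition A T Phi ->
  forward_solution A t T z (fun=> 0) (fun s => Phi s t *m z).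
Proof.
move=> tT bA /(_ t tT)[cPhi PhiE].
have bPhi := within_continuous_bounded_measurable_mx cPhi.
have tS : `[t, T] `<=` `[0, T] by apply: subset_segment; lra.
split.
  apply: bounded_measurable_mxM; last exact: bounded_measurable_mx_cst.
  exact: bounded_measurable_mxS bPhi.
move=> s sT i.
have sS : `[t, s] `<=` `[0, T] by apply: subset_segment; lra.
have bAP k j : bounded_measurable `[t, s] (fun r => (A r *m Phi r t) k j).
  by apply: (bounded_measurableS _ sS) => //; exact: bounded_measurable_mxM.
rewrite (@Rint_ext _ _ _ _ (fun r => \sum_j z j 0 * (A r *m Phi r t) i j)); last first.
  by move=> r _; rewrite addr0 mulmxA mxE; apply: eq_bigr => j _; rewrite mulrC.
rewrite Rint_sum; last first.
  by move=> j; apply: bounded_measurableM => //; exact: bounded_measurable_cst.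
have -> : z i 0 = \sum_j (1%:M : 'M[R]_n) i j * z j 0.
  by rewrite -[in LHS](mul1mx z) mxE.
rewrite mxE -big_split/=; apply: eq_bigr => j _; rewrite RintZ//.
rewrite PhiE; last lra.
by rewrite /oint; have [-> _] := andP sT; ring.
Qed.

(** [conv_hull] is an intersection of convex sets, so one convex set containing the [xis k i t]
    suffices to reach every point of the hull. *)
Lemma reachable_sublevel_convex n m l (A : R -> 'M[R]_n) (B : R -> 'M[R]_(n, m))
    (E : R -> 'M[R]_(n, l)) (U : set 'cV[R]_m) (D : set 'cV[R]_l)
    (g : 'cV[R]_n -> R) (t T c : R) :
  bounded_measurable_mx `[t, T] A -> is_convex_set U -> is_convex_fun g ->
  is_convex_set [set y | exists w zeta, [/\ bounded_measurable_mx `[t, T] w,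
    forall s, t <= s <= T -> Wset B E U D s (w s),
    forward_solution A t T y w zeta & g (zeta T) <= c]].
Proof.
move=> bA cU cg y y' [w [zeta [bw wW sz gz]]] [w' [zeta' [bw' wW' sz' gz']]] lam lam01.
exists (fun r => lam *: w r + (1 - lam) *: w' r).
exists (fun r => lam *: zeta r + (1 - lam) *: zeta' r); split.
- by apply: bounded_measurable_mxD; exact: bounded_measurable_mxZ.
- by move=> s sT; apply: Wset_convex => //; [exact: wW|exact: wW'].
- exact: forward_solution_comb.
- apply: le_trans (cg _ _ _ lam01) _; have /andP[l0 l1] := lam01.
  have : lam * g (zeta T) <= lam * c by apply: ler_wpM2l.
  have : (1 - lam) * g (zeta' T) <= (1 - lam) * c by apply: ler_wpM2l => //; lra.
  lra.
Qed.

Lemma enorm_le n (v : 'cV[R]_n) (e : R) : 0 <= e -> (forall i, `|v i 0| <= e) ->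
  enorm v <= n%:R * e.
Proof.
move=> e0 ve; have ne0 : 0 <= n%:R * e by rewrite mulr_ge0.
rewrite /enorm -(ger0_norm ne0) -sqrtr_sqr; apply: ler_wsqrtr.
apply: le_trans (_ : \sum_(i < n) e ^+ 2 <= _).
  by apply: ler_sum => i _; rewrite -real_normK ?num_real// lerXn2r ?nnegrE.
rewrite sumr_const card_ord -[leLHS]mulr_natl exprMn ler_wpM2r ?sqr_ge0//.
by rewrite -natrX ler_nat; case: n {v ve ne0} => // n; rewrite -mulnn leq_pmulr.
Qed.

End reachability.

Theorem theorem3 (R : realType) (n m l : nat) (T : R)
  (A : R -> 'M[R]_n) (B : R -> 'M[R]_(n, m)) (E : R -> 'M[R]_(n, l))
  (U : set 'cV[R]_m) (D : set 'cV[R]_l) (g : 'cV[R]_n -> R) (Lg : R)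
  (N : nat) (gam : 'I_N -> R) (nk : 'I_N -> nat)
  (xbar : forall k : 'I_N, 'I_(nk k) -> 'cV[R]_n)
  (omega : forall k : 'I_N, 'I_(nk k) -> R -> 'cV[R]_n)
  (xis : forall k : 'I_N, 'I_(nk k) -> R -> 'cV[R]_n)
  (Phi : R -> R -> 'M[R]_n) :
  0 < T ->
  {within `[0, T], continuous A} ->
  {within `[0, T], continuous B} ->
  {within `[0, T], continuous E} ->
  compact U -> is_convex_set U -> U !=set0 ->
  compact D -> is_convex_set D -> D !=set0 ->
  continuous g ->
  (* (i) *)
  is_convex_fun g -> 0 <= Lg ->
  (forall x y, `|g x - g y| <= Lg * enorm (x - y)) ->
  (* (ii) *)
  (forall t, 0 <= t <= T -> Wset B E U D t !=set0) ->
  (0 < N)%N -> (forall k, 0 < nk k)%N ->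
  (forall k, exists y, g y = gam k) ->
  (forall k i, g (xbar k i) = gam k) ->
  (forall k i, admissible 0 T (Wset B E U D) (omega k i)) ->
  (forall k i, is_backward_traj A T (xbar k i) (omega k i) (xis k i)) ->
  is_state_transition A T Phi ->
  forall (t : R) (x : 'cV[R]_n), 0 <= t <= T ->
    (value A B E U D g T t x <= vbar Lg gam xis Phi T t x)%E.
Proof.
move=> T0 cA cB cE cU convU U0 cD _ D0 _ convg Lg0 lipg _ _ nk0 _ gxbar aom bxis sPhi.
move=> t x tT; have [t0 tT'] := andP tT.
have bA := within_continuous_bounded_measurable_mx cA.
have bB := within_continuous_bounded_measurable_mx cB.
have bE := within_continuous_bounded_measurable_mx cE.
have tS : `[t, T] `<=` `[0, T] by apply: subset_segment.
have bAt := bounded_measurable_mxS (measurable_itv _) tS bA.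
have cS p q (F : R -> 'M[R]_(p, q)) : {within `[0, T], continuous F} ->
  {within `[t, T], continuous F} by exact: continuous_subspaceW.
apply: ge_ereal_sup => _ [delta dna <-]; apply: le_ereal_inf_tmp => _ [k _ <-].
set V := ereal_inf _.
(* Strategy and level being fixed, each point of the hull gives a bound; the infimum over the hull
   is taken afterwards. *)
have key y : conv_hull (range (fun i => xis k i t)) y ->
    (V <= (Lg * enorm (Phi T t *m (x - y)) + gam k)%:E)%E.
  move=> hully.
  have [|w [zeta [bw wW sz gz]]] := hully [set y | exists w zeta,
    [/\ bounded_measurable_mx `[t, T] w,
      forall s, t <= s <= T -> Wset B E U D s (w s),
      forward_solution A t T y w zeta & g (zeta T) <= gam k]].
    split; first exact: reachable_sublevel_convex.
    move=> _ [i _ <-]; exists (omega k i), (xis k i).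
    have bom := Wset_admissible_bounded_measurable bB bE cU D0 (aom k i).
    have [fs xT] := backward_forward_solution tT bA bom (bxis k i).
    split => //; first exact: bounded_measurable_mxS bom.
      by move=> s sT; apply: (aom k i).2; lra.
    by rewrite xT gxbar.
  have sphi := state_transition_forward_solution (x - y) tT bA sPhi.
  apply/lee_addgt0Pr => e e0; rewrite -EFinD.
  (* An entrywise error [e / c] is an Euclidean error of at most [n%:R * (e / c)], which [g] turns
     into at most [e]. *)
  pose c := Lg * n%:R + 1.
  have c0 : 0 < c by rewrite ltr_wpDl// mulr_ge0.
  have [u [xi [au trxi Hxi]]] := strategy_steering tT' (cS _ _ _ cA) (cS _ _ _ cB)
    (cS _ _ _ cE) cU U0 cD bw wW sz sphi dna (divr_gt0 e0 c0).
  apply: ge_ereal_inf; exists (g (xi T))%:E; first by exists xi => //; exists u.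
  rewrite lee_fin.
  (* The Lipschitz bound is used twice: for the steering error, and for the offset
     [Phi T t *m (x - y)] from [zeta T]. *)
  have := lipg (xi T) (zeta T + Phi T t *m (x - y)).
  have := lipg (zeta T + Phi T t *m (x - y)) (zeta T).
  rewrite (addrC (zeta T)) addrK -(addrC (zeta T)) => H1 H2.
  have H3 := enorm_le (ltW (divr_gt0 e0 c0)) Hxi.
  have : Lg * enorm (xi T - (zeta T + Phi T t *m (x - y))) <= e.
    apply: le_trans (ler_wpM2l Lg0 H3) _.
    rewrite mulrA mulrCA ler_piMr ?(ltW e0)// ler_pdivrMr// mul1r /c; lra.
  move: H1 H2; rewrite !ler_norml; lra.
set S := [set _ | y in _].
have [y0 hy0] : exists y, conv_hull (range (fun i => xis k i t)) y.
  exists (xis k (Ordinal (nk0 k)) t) => C [_ rC]; apply: rC.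
  by exists (Ordinal (nk0 k)).
have S0 : (0 <= ereal_inf S)%E.
  by apply: le_ereal_inf_tmp => _ [y _ <-]; rewrite lee_fin sqrtr_ge0.
(* Finiteness, due to a point of the hull, allows near-minimisers and turns the product with [Lg]
   into one of reals. *)
have Sfin : ereal_inf S \is a fin_num.
  rewrite ge0_fin_numE//; apply: le_lt_trans (ltry (enorm (Phi T t *m (x - y0)))).
  by apply: ge_ereal_inf; exists (enorm (Phi T t *m (x - y0)))%:E => //; exists y0.
apply/lee_addgt0Pr => e e0.
(* [Lg] may be [0], hence the division by [Lg + 1]. *)
have e1 : 0 < e / (Lg + 1) by rewrite divr_gt0// ltr_wpDl.
have [_ [y hy <-]] := lb_ereal_inf_adherent e1 Sfin.
rewrite -(fineK Sfin) -EFinD lte_fin => yS.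
apply: le_trans (key y hy) _; rewrite -EFinM -!EFinD lee_fin.
have := ler_wpM2l Lg0 (ltW yS); rewrite mulrDr.
have : Lg * (e / (Lg + 1)) <= e.
  rewrite mulrCA ler_piMr ?(ltW e0)// ler_pdivrMr ?mul1r; lra.
lra.
Qed.
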